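(* Let $W$ be a complex vector space of dimension 6, let $\mathbb{P}(A)\subset\mathbb{P}(\bigwedge^2W^* )$ be an $n$-dimensional linear space, and let $\omega_0,\ldots,\omega_n$ be an $(n+1)$-tuple of generators of $A$. For a choice of coordinates (a basis) on $W$, denote by $M_k=(m_{ij}^k)$, $k=0,\ldots,n$, the $6\times6$ skew-symmetric matrix representing the form $\omega_k$. (1) $\mathbb{P}(A)$ is not semistable if and only if, for some choice of coordinates on $W$, there exists an integer $1\le s\le 3$ such that $m_{ij}^k=0$ whenever $1\le i\le s$, $i<j\le 7-s$, $0\le k\le n$. (2) $\mathbb{P}(A)$ is not stable if and only if, for some choice of coordinates on $W$, there exists an integer $1\le s\le 3$ such that $m_{ij}^k=0$ whenever $1\le i\le s$, $i<j\le 6-s$, $0\le k\le n$.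
   Context: The base field is $\mathbb{C}$. $\mathbb{P}(\bigwedge^2 W^* )$ is the projective space of lines in the space $\bigwedge^2W^*$ of skew-symmetric bilinear forms on $W$. An $n$-dimensional linear space (linear system of skew-symmetric forms) is $\mathbb{P}(A)\subset \mathbb{P}(\bigwedge^2W^* )$ with $A\subset\bigwedge^2W^*$ a linear subspace of dimension $n+1$. Action and stability: $g\in GL(W)$ acts on forms by $M_\omega\mapsto gM_\omega g^T$ on the representing skew-symmetric matrices. Let $V_{n+1}$ be a complex vector space of dimension $n+1$. Choosing an injective linear map $\phi:V_{n+1}\to\bigwedge^2W^*$ with image $A$, one regards $A$ as a vector of $V_{n+1}^*\otimes\bigwedge^2W^*$, on which $SL(W)$ acts through the second factor. $\mathbb{P}(A)$ is semistable if $0\notin\overline{SL(W)\cdot A}$ (closure of the orbit in $V_{n+1}^*\otimes\bigwedge^2W^*$); it is stable if the orbit $SL(W)\cdot A$ is closed in $V_{n+1}^*\otimes\bigwedge^2W^*$ and the stabilizer of $A$ (as a vector of this space) in $SL(W)$ is finite. These notions do not depend on the choice of $\phi$. *)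

(* Defs.v *)
From HB Require Import structures.
From mathcomp Require Import all_boot all_order all_algebra.
From mathcomp Require Import complex.
From mathcomp Require Import all_classical all_reals all_analysis.

Set Implicit Arguments.
Unset Strict Implicit.
Unset Printing Implicit Defensive.

Import Order.TTheory GRing.Theory Num.Theory.
Import numFieldNormedType.Exports.
Import passmx.

Local Open Scope ring_scope.
Local Open Scope classical_set_scope.
Local Open Scope complex_scope.

(* The base field is R[i] for R : realType. The regular-module alias R[i]^o is
   the type that carries both the one-dimensional vector space structure and
   the Euclidean topology given by the complex norm. *)

Definition bilform (R : realType) (W : vectType R[i]) : vectType R[i] :=
  'Hom(W, 'Hom(W, R[i]^o)).

Definition skew_symmetric (R : realType) (W : vectType R[i])
    (w : bilform W) : Prop :=
  forall x y : W, w x y = - w y x.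

Definition form_matrix (R : realType) (W : vectType R[i]) (d : nat)
    (e : d.-tuple W) (w : bilform W) : 'M[R[i]]_d :=
  \matrix_(i, j) w (tnth e i) (tnth e j).

(* The determinant does not depend on the basis. *)
Definition lfun_det (R : realType) (W : vectType R[i]) (g : 'End(W)) : R[i] :=
  \det (mxof (vbasis {:W}) (vbasis {:W}) g).

Definition SL (R : realType) (W : vectType R[i]) : set 'End(W) :=
  [set g | lfun_det g = 1].
Arguments SL {R} W _.

Definition pullback_fun (R : realType) (W : vectType R[i])
    (g : 'End(W)) (w : bilform W) (x : W) : 'Hom(W, R[i]^o) :=
  (w (g x) \o g)%VF.

Lemma pullback_fun_linear (R : realType) (W : vectType R[i])
    (g : 'End(W)) (w : bilform W) : linear (pullback_fun g w).
Proof.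
move=> a u v; apply/lfunP => z.
rewrite add_lfunE scale_lfunE !comp_lfunE !linearP.
by rewrite add_lfunE scale_lfunE.
Qed.

HB.instance Definition _ (R : realType) (W : vectType R[i])
    (g : 'End(W)) (w : bilform W) :=
  GRing.isSemilinear.Build R[i] _ _ _ (pullback_fun g w)
    (GRing.semilinear_linear (pullback_fun_linear g w)).

(* (x, y) |-> w (g x) (g y). Matrices act on row vectors (the convention of
   mxof), so if G is the matrix of g and M that of w in some basis, then
   the matrix of pullback g w is G *m M *m G^T; see form_matrix_pullback. *)
Definition pullback (R : realType) (W : vectType R[i])
    (g : 'End(W)) (w : bilform W) : bilform W :=
  linfun (pullback_fun g w).

Lemma pullbackE (R : realType) (W : vectType R[i])
    (g : 'End(W)) (w : bilform W) (x y : W) :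
  pullback g w x y = w (g x) (g y).
Proof. by rewrite /pullback lfunE /= comp_lfunE. Qed.

Lemma form_matrix_pullback (R : realType) (W : vectType R[i])
    (e : (\dim {:W}).-tuple W) (g : 'End(W)) (w : bilform W) :
  basis_of {:W} e ->
  form_matrix e (pullback g w) =
    mxof e e g *m form_matrix e w *m (mxof e e g)^T.
Proof.
move=> be.
have ge i : g (tnth e i) = \sum_j mxof e e g i j *: tnth e j.
  rewrite (tnth_nth 0) -[g _](rVofK be) (rVof_app _ be) (rVofE be) -rowE.
  rewrite /vecof; apply: eq_bigr => j _.
  by rewrite mxE (tnth_nth 0).
apply/matrixP => i j; rewrite [LHS]mxE pullbackE (ge j) linear_sum mxE.
apply: eq_bigr => l _; rewrite linearZ /= (ge i) linear_sum sum_lfunE.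
rewrite [(mxof e e g)^T l j]mxE [RHS]mulrC.
congr (_ * _); rewrite [RHS]mxE; apply: eq_bigr => k _.
by rewrite linearZ scale_lfunE [form_matrix e w k l]mxE.
Qed.

Lemma pullback_linear (R : realType) (W : vectType R[i]) (g : 'End(W)) :
  linear (pullback g).
Proof.
move=> a u v; apply/lfunP => x; apply/lfunP => y.
rewrite add_lfunE scale_lfunE add_lfunE scale_lfunE !pullbackE.
by rewrite !add_lfunE !scale_lfunE.
Qed.

HB.instance Definition _ (R : realType) (W : vectType R[i]) (g : 'End(W)) :=
  GRing.isSemilinear.Build R[i] _ _ _ (pullback g)
    (GRing.semilinear_linear (pullback_linear g)).

(* A vector of V^* (x) Lambda^2 W^* is a linear map from V to the skew-symmetric
   forms; GL(W) acts through the second factor. *)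
Definition act (R : realType) (V W : vectType R[i])
    (g : 'End(W)) (phi : 'Hom(V, bilform W)) : 'Hom(V, bilform W) :=
  (linfun (pullback g) \o phi)%VF.

Lemma actE (R : realType) (V W : vectType R[i])
    (g : 'End(W)) (phi : 'Hom(V, bilform W)) (v : V) :
  act g phi v = pullback g (phi v).
Proof. by rewrite comp_lfunE lfunE. Qed.

Definition SL_orbit (R : realType) (V W : vectType R[i])
    (phi : 'Hom(V, bilform W)) : set 'Hom(V, bilform W) :=
  [set act g phi | g in SL W].

Definition SL_stabilizer (R : realType) (V W : vectType R[i])
    (phi : 'Hom(V, bilform W)) : set 'End(W) :=
  [set g | SL W g /\ act g phi = phi].

(* Closure for the canonical topology of a finite-dimensional complex vector
   space, computed in coordinates. For the orbits below it coincides with the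
   Zariski closure, since an orbit of an algebraic group is constructible. *)
Definition vclosure (R : realType) (U : vectType R[i]) (S : set U) : set U :=
  let coords (u : U) : 'rV[R[i]^o]_(\dim {:U}) := rVof (vbasis {:U}) u in
  [set u | closure [set coords v | v in S] (coords u)].

(* The orbit of a phi with skew-symmetric values lies in the linear, hence closed,
   subspace Hom(V, Lambda^2 W^* ) of Hom(V, bilform W), so its closures in the
   subspace and in the ambient space agree. *)
Definition semistable (R : realType) (V W : vectType R[i])
    (phi : 'Hom(V, bilform W)) : Prop :=
  ~ vclosure (SL_orbit phi) 0.

Definition stable (R : realType) (V W : vectType R[i])
    (phi : 'Hom(V, bilform W)) : Prop :=
  vclosure (SL_orbit phi) = SL_orbit phi /\ finite_set (SL_stabilizer phi).

(* Main.v *)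
Require Import Defs.
From HB Require Import structures.
From mathcomp Require Import all_boot all_order all_algebra fingroup perm.
From mathcomp Require Import complex finmap.
From mathcomp Require Import all_classical all_reals all_analysis.
From mathcomp Require Import zify ring.

Set Implicit Arguments.
Unset Strict Implicit.
Unset Printing Implicit Defensive.

Import Order.TTheory GRing.Theory Num.Theory.
Import numFieldNormedType.Exports.
Import passmx.

Local Open Scope ring_scope.
Local Open Scope classical_set_scope.
Local Open Scope complex_scope.

(**
Write [g.M] for the tuple of matrices [g *m M_k *m g^T].

If [det g = 1], the singular value decomposition [P *m g = diag d *m Q], with [d]
positive decreasing of product 1, gives [(P g).M_ij = d_i d_j (Q.M)_ij].  When no
basis has the vanishing pattern of size [s], the norm of the pattern entries of
[Q.M] is bounded below on the compact set of unitary [Q].  One of [d_1 d_6],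
[d_2 d_5], [d_3 d_4] is at least 1, so in case (1) the orbit stays away from 0.
In case (2) a bound on [g.M] bounds [d_1 d_5], [d_2 d_4] and [d_2 d_3], hence
[d_1]: the orbit map is proper and the orbit closed.  This replaces the
Hilbert-Mumford theorem.

The stabilizer is finite by algebra alone.  If [g] preserves all the forms, then
the image of [g - a] is orthogonal to the eigenspace of [a^-1].  If an eigenvalue
[a] differs from [a^-1], or if the image and the kernel of [g - a] meet, this
produces a pattern of case (2).  Otherwise [g^2 = 1] for every such [g], and a
group of involutions in [GL(W)] is commutative and finite.

Conversely, a pattern gives an integral one-parameter subgroup whose limit on [M]
is 0 in case (1), and is fixed by the whole infinite subgroup in case (2); a closed
orbit would contain this limit, and [M] would have an infinite stabilizer.
*)

(** * The singular value decomposition *)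

Section SingularValues.
Local Open Scope sesquilinear_scope.
Variables (C : numClosedFieldType) (n : nat).
Implicit Types (P Q G : 'M[C]_n) (d : 'rV[C]_n).

Lemma mulmx_conjtr_diagE (m : nat) (A : 'M[C]_(n, m)) i :
  (A *m A ^t*) i i = \sum_j `|A i j| ^+ 2.
Proof. by rewrite mxE; apply: eq_bigr => j _; rewrite !mxE normCK. Qed.

Lemma norm_unitarymx_le1 P i j : P \is unitarymx -> `|P i j| <= 1.
Proof.
move=> /unitarymxP PP1; rewrite -(@expr_le1 _ 2%N) //.
have -> : 1 = \sum_j `|P i j| ^+ 2 by rewrite -mulmx_conjtr_diagE PP1 mxE eqxx.
by rewrite (bigD1 j) //= lerDl sumr_ge0 // => k _; rewrite exprn_ge0.
Qed.

Lemma norm_det_unitarymx P : P \is unitarymx -> `|\det P| = 1.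
Proof.
move=> /unitarymxP/(congr1 determinant); rewrite det_mulmx det_map_mx det_tr.
rewrite det1 -normCK => /eqP; rewrite expr2 -normrM -expr2 normrX => /eqP H.
by apply/eqP; rewrite -(@eqrXn2 _ 2%N) ?expr1n ?H.
Qed.

Lemma perm_mx_unitary (s : 'S_n) : perm_mx s \is @unitarymx C n n.
Proof.
apply/unitarymxP; rewrite tr_perm_mx map_perm_mx -perm_mxM.
by rewrite mulgV perm_mx1.
Qed.

(** The spectral theorem for the normal matrix [A], which is [G] times its adjoint, gives a unitary
    [P] such that [B = P *m G] has orthogonal rows of squared norms [sp]. Dividing these rows by the
    square roots [d] of [sp] yields the unitary [Q]. *)
Lemma svd G : \det G != 0 ->
  exists P Q d, [/\ P \is unitarymx, Q \is unitarymx,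
    forall i, 0 < d 0 i & P *m G = diag_mx d *m Q].
Proof.
move=> dG; set A := G *m G ^t*.
have /orthomx_spectralP : A \is normalmx.
  by apply/normalmxP; rewrite /A trmx_mul map_mxM /= trmxCK.
set P := spectralmx A; set sp := spectral_diag A => AE.
have uP : P \is unitarymx := spectral_unitarymx A.
set B := P *m G.
have BB : B *m B ^t* = diag_mx sp.
  rewrite /B trmx_mul map_mxM mulmxA -(mulmxA P) -/A AE.
  rewrite invmx_unitary // !mulmxA (unitarymxP uP) mul1mx -mulmxA.
  by rewrite (unitarymxP uP) mulmx1.
have detB : \det B != 0.
  by rewrite det_mulmx mulf_neq0 // -normr_eq0 norm_det_unitarymx ?oner_eq0.
have sp_gt0 i : 0 < sp 0 i.
  rewrite lt_neqAle eq_sym; apply/andP; split; last first.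
    have := mulmx_conjtr_diagE B i; rewrite BB mxE eqxx mulr1n => ->.
    by apply: sumr_ge0 => j _; rewrite exprn_ge0.
  have /eqP := congr1 determinant BB.
  rewrite det_mulmx det_map_mx det_tr det_diag => /eqP H; apply/eqP => sp0.
  move: H; rewrite (bigD1 i) //= sp0 mul0r => /eqP.
  by rewrite mulf_eq0 conjC_eq0 orbb (negPf detB).
pose d := \row_i sqrtC (sp 0 i).
have d_gt0 i : 0 < d 0 i by rewrite mxE sqrtC_gt0.
pose d' := \row_i (d 0 i)^-1.
exists P, (diag_mx d' *m B), d; split => //.
- apply/unitarymxP; rewrite trmx_mul map_mxM mulmxA -(mulmxA _ B) BB.
  rewrite tr_diag_mx map_diag_mx !mulmx_diag -diag_const_mx; congr diag_mx.
  apply/rowP => i; rewrite !mxE -{2}(sqrtCK (sp 0 i)).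
  have sq_gt0 : 0 < sqrtC (sp 0 i) by rewrite sqrtC_gt0.
  rewrite /= conj_Creal ?rpredV ?gtr0_real // expr2.
  by rewrite mulrA mulVf ?lt0r_neq0 // mul1r mulfV ?lt0r_neq0.
- rewrite mulmxA mulmx_diag (_ : diag_mx _ = 1%:M) ?mul1mx //.
  rewrite -diag_const_mx; congr diag_mx.
  by apply/rowP => i; rewrite !mxE mulfV // lt0r_neq0 // sqrtC_gt0.
Qed.

(** The order of [C] is total only on real elements, so the sort is controlled on that subset. *)
Lemma sorting_perm (f : 'I_n -> C) : (forall i, f i \is Num.real) ->
  exists s : 'S_n, forall i j : 'I_n, (i <= j)%N -> f (s j) <= f (s i).
Proof.
move=> f_real; pose t := [tuple f i | i < n].
pose r := (fun x y : C => y <= x).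
have t_real : all (fun x => x \is Num.real) t.
  by apply/allP => x /mapP[i _ ->].
have srt : sorted r (sort r t).
  by apply: (@sort_sorted_in _ [pred x : C | x \is Num.real]) t_real => x y xR yR;
    rewrite /r; exact: real_leVge.
have /tuple_permP[s sE] : perm_eq (sort_tuple r t) t by rewrite perm_sort.
exists s => i j ij; have srt' : sorted r (sort_tuple r t) by exact: srt.
rewrite sE in srt'.
have := @sorted_leq_nth _ r _ _ 0 _ srt' i j.
rewrite !inE !size_map -!enumT size_enum_ord !ltn_ord.
rewrite !(nth_map i) -?enumT ?size_enum_ord //.
rewrite !nth_ord_enum !tnth_mktuple; apply => //.
- by move=> y x z; rewrite /r => yx zy; exact: le_trans zy yx.
- by move=> x; rewrite /r.
Qed.

Lemma svd_sorted G : \det G != 0 ->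
  exists P Q d, [/\ P \is unitarymx, Q \is unitarymx,
    forall i, 0 < d 0 i, forall i j : 'I_n, (i <= j)%N -> d 0 j <= d 0 i &
    P *m G = diag_mx d *m Q].
Proof.
move=> /svd[P [Q [d [uP uQ d_gt0 PGE]]]].
have [s sP] := @sorting_perm (d 0) (fun i => gtr0_real (d_gt0 i)).
exists (perm_mx s *m P), (perm_mx s *m Q), (\row_i d 0 (s i)); split.
- by rewrite mul_unitarymx ?perm_mx_unitary.
- by rewrite mul_unitarymx ?perm_mx_unitary.
- by move=> i; rewrite mxE.
- by move=> i j ij; rewrite !mxE sP.
- rewrite -mulmxA PGE -!row_permE; apply/matrixP => i j.
  by rewrite !mul_diag_mx !mxE.
Qed.

Lemma prod_singular_values G P Q d : \det G = 1 -> P \is unitarymx ->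
    Q \is unitarymx -> (forall i, 0 < d 0 i) -> P *m G = diag_mx d *m Q ->
  \prod_i d 0 i = 1.
Proof.
move=> dG uP uQ d_gt0 /(congr1 (fun M => `|\det M|)).
rewrite !det_mulmx !normrM dG (norm_det_unitarymx uP) (norm_det_unitarymx uQ).
rewrite normr1 !mulr1.
rewrite det_diag ger0_norm => [<- //|].
by apply: prodr_ge0 => i _; rewrite ltW.
Qed.

End SingularValues.

(** * Pair products of six positive numbers with product 1 *)

Section SixNumbers.
Variables (C : numClosedFieldType) (d : 'I_6 -> C).
Hypotheses (d_gt0 : forall i, 0 < d i) (prod_d : \prod_i d i = 1).

Let a k := d (inord k).
Let a_gt0 k : 0 < a k. Proof. exact: d_gt0. Qed.

Let prod6E : a 0 * a 1 * a 2 * a 3 * a 4 * a 5 = 1.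
Proof.
rewrite -prod_d !big_ord_recl big_ord0 mulr1 !mulrA /a.
do ?[congr (_ * _)]; congr d; apply: val_inj => /=; rewrite inordK //=.
Qed.

(** The three pair products multiply to 1, so they are not all below 1. The 0-based pair
    [(s.-1, 6 - s)] is the corner of the case (1) pattern of size [s], where [d_i d_j] is smallest
    when [d] decreases. *)
Lemma exists_outer_pair_ge1 :
  exists2 s, (1 <= s <= 3)%N & 1 <= d (inord s.-1) * d (inord (6 - s)).
Proof.
have aR k : a k \is Num.real by rewrite gtr0_real.
have prodE : (a 0 * a 5) * (a 1 * a 4) * (a 2 * a 3) = 1.
  by rewrite -[RHS]prod6E; ring.
have [h|h1] := real_leP (real1 _) (realM (aR 0) (aR 5)); first by exists 1%N.
have [h|h2] := real_leP (real1 _) (realM (aR 1) (aR 4)); first by exists 2%N.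
have [h|h3] := real_leP (real1 _) (realM (aR 2) (aR 3)); first by exists 3%N.
suff : (a 0 * a 5) * (a 1 * a 4) * (a 2 * a 3) < 1 by rewrite prodE ltxx.
have p_ge0 k l : 0 <= a k * a l by rewrite mulr_ge0 ?ltW.
by apply: mulr_ilt1 => //; [exact: mulr_ge0 | exact: mulr_ilt1].
Qed.

(** From [a2^2 <= a1 a2 <= m <= m^2] follows [a2 <= m]. Then [(a0 a4)(a1 a3)(a2 a5) = 1] gives
    [1 <= m^3 a5], and [a0 <= m^3 a0 a5 <= m^3 a0 a4 <= m^4]. *)
Lemma largest_le_of_inner_pairs (m : C) :
    (forall i j : 'I_6, (i <= j)%N -> d j <= d i) -> 1 <= m ->
    d (inord 0) * d (inord 4) <= m -> d (inord 1) * d (inord 3) <= m ->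
    d (inord 1) * d (inord 2) <= m ->
  forall i, d i <= m ^+ 4.
Proof.
move=> d_mono m_ge1; rewrite -/(a 0) -/(a 1) -/(a 2) -/(a 3) -/(a 4) => h04 h13 h12.
have a_mono i j : (i <= j < 6)%N -> a j <= a i.
  move=> /andP[ij j6]; apply: d_mono; rewrite !inordK //.
  exact: leq_ltn_trans ij j6.
have m_gt0 : 0 < m := lt_le_trans ltr01 m_ge1.
have a2_le : a 2 <= m.
  rewrite -(@ler_pXn2r _ 2) ?nnegrE ?(ltW (a_gt0 _)) ?(ltW m_gt0) //.
  apply: (@le_trans _ _ m); last by rewrite expr2 ler_peMr // ltW.
  apply: le_trans h12; rewrite expr2 ler_wpM2r ?(ltW (a_gt0 _)) //.
  exact: a_mono.
have prodE : (a 0 * a 4) * (a 1 * a 3) * (a 2 * a 5) = 1.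
  by rewrite -[RHS]prod6E; ring.
have a5_ge : 1 <= m ^+ 3 * a 5.
  rewrite -prodE (_ : m ^+ 3 * a 5 = m * m * (m * a 5)); last by ring.
  have a_ge0 k := ltW (a_gt0 k).
  by apply: ler_pM; rewrite ?mulr_ge0 // ?ler_wpM2r // ler_pM ?mulr_ge0.
have a0_le : a 0 <= m ^+ 4.
  apply: (@le_trans _ _ (a 0 * (m ^+ 3 * a 5))); first by rewrite ler_peMr // ltW.
  rewrite mulrCA (exprSr m 3); apply: ler_wpM2l; first by rewrite exprn_ge0 // ltW.
  apply: le_trans h04; rewrite ler_wpM2l ?(ltW (a_gt0 _)) //; exact: a_mono.
move=> i; apply: le_trans a0_le; apply: d_mono.
by rewrite inordK.
Qed.

End SixNumbers.

(** * Estimates of matrix entries by singular values *)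

Section SingularEstimates.
Local Open Scope sesquilinear_scope.
Variables (C : numClosedFieldType) (m n : nat).

Definition l1norm (p q : nat) (A : 'M[C]_(p, q)) : C := \sum_i \sum_j `|A i j|.

Lemma norm_conj_unitary_le (P A : 'M[C]_n) i j : P \is unitarymx ->
  `|(P *m A *m P^T) i j| <= l1norm A.
Proof.
move=> uP; rewrite mxE (le_trans (ler_norm_sum _ _ _)) //.
rewrite /l1norm exchange_big; apply: ler_sum => k _ /=.
rewrite normrM; apply: (@le_trans _ _ `|(P *m A) i k|).
  by rewrite ler_piMr // mxE norm_unitarymx_le1.
rewrite mxE (le_trans (ler_norm_sum _ _ _)) //; apply: ler_sum => l _.
by rewrite normrM ler_piMl // norm_unitarymx_le1.
Qed.

Variables (G P Q : 'M[C]_n) (d : 'rV[C]_n).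
Hypotheses (uP : P \is unitarymx) (uQ : Q \is unitarymx).
Hypotheses (d_gt0 : forall i, 0 < d 0 i) (PGE : P *m G = diag_mx d *m Q).

Lemma svd_conjE (A : 'M[C]_n) i j :
  (P *m (G *m A *m G^T) *m P^T) i j =
    d 0 i * d 0 j * (Q *m A *m Q^T) i j.
Proof.
rewrite !mulmxA PGE -(mulmxA _ G^T) -trmx_mul PGE trmx_mul tr_diag_mx.
by rewrite !mulmxA mul_mx_diag -!mulmxA mul_diag_mx !mxE mulrAC.
Qed.

Lemma norm_svd_le (b : C) i j : (forall k, d 0 k <= b) -> `|G i j| <= b *+ n.
Proof.
move=> d_le; have -> : G = P ^t* *m (diag_mx d *m Q).
  by rewrite -PGE -invmx_unitary // mulKmx // unitarymx_unit.
rewrite mxE (le_trans (ler_norm_sum _ _ _)) //.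
rewrite -[X in _ *+ X]card_ord -sumr_const; apply: ler_sum => k _.
rewrite mul_diag_mx [(\matrix_(_, _) _) k j]mxE !normrM (ger0_norm (ltW (d_gt0 k))).
have d_ge0 := ltW (d_gt0 k).
have P_le1 : `|P ^t* i k| <= 1 by rewrite norm_unitarymx_le1 // trmxC_unitary.
apply: (le_trans (ler_piMl _ P_le1)); first by rewrite mulr_ge0.
by apply: le_trans (d_le k); rewrite ler_piMr // norm_unitarymx_le1.
Qed.

Variable M : 'I_m -> 'M[C]_n.

(** On [D] the entries of [(P G).M] are those of [Q.M] times [d_i d_j >= b], and each entry of
    [(P G).M] is at most the l1 norm of [G.M]. The factor [n * n] bounds the number of positions in
    [D]. *)
Lemma singular_pattern_bound (D : pred ('I_n * 'I_n)) (b c : C) :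
    0 <= b ->
    (forall ij, D ij -> b <= d 0 ij.1 * d 0 ij.2) ->
    c <= \sum_k \sum_(ij | D ij) `|(Q *m M k *m Q^T) ij.1 ij.2| ->
  b * c <= (\sum_k l1norm (G *m M k *m G^T)) *+ (n * n).
Proof.
move=> b_ge0 bD cle; apply: (le_trans (ler_wpM2l b_ge0 cle)).
rewrite mulr_sumr -sumrMnl; apply: ler_sum => k _.
rewrite mulr_sumr.
apply: (@le_trans _ _ (\sum_(ij | D ij) l1norm (G *m M k *m G^T))); last first.
  rewrite sumr_const; apply: ler_wpMn2l.
    by apply: sumr_ge0 => i _; apply: sumr_ge0.
  by apply: leq_trans (max_card _) _; rewrite card_prod card_ord.
apply: ler_sum => -[i j] Dij /=.
apply: le_trans (norm_conj_unitary_le _ i j uP).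
rewrite svd_conjE normrM ler_wpM2r //.
by rewrite ger0_norm ?mulr_ge0 ?(ltW (d_gt0 _)) //; exact: (bD (i, j)).
Qed.

End SingularEstimates.

(** * Continuity and compactness for complex matrices *)

Section Continuity.
Variables (K : numFieldType) (T : topologicalType).

Lemma continuous_mul (f g : T -> K^o) :
  continuous f -> continuous g -> continuous (fun x => f x * g x : K^o).
Proof. by move=> cf cg x; apply: continuousM; [exact: cf|exact: cg]. Qed.

Lemma continuous_add (f g : T -> K^o) :
  continuous f -> continuous g -> continuous (fun x => f x + g x : K^o).
Proof. by move=> cf cg x; apply: continuousD; [exact: cf|exact: cg]. Qed.

Lemma continuous_sum (I : Type) (r : seq I) (P : pred I) (f : I -> T -> K^o) :
    (forall i, P i -> continuous (f i)) ->
  continuous (fun x => \sum_(i <- r | P i) f i x : K^o).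
Proof.
move=> cf; elim: r => [|i r IHr].
  by under eq_fun do rewrite big_nil; move=> x; exact: cvg_cst.
case Pi: (P i); under eq_fun do rewrite big_cons Pi; last exact: IHr.
by move=> x; apply: continuousD; [exact: cf|exact: IHr].
Qed.

Lemma continuous_prod (I : Type) (r : seq I) (P : pred I) (f : I -> T -> K^o) :
    (forall i, P i -> continuous (f i)) ->
  continuous (fun x => \prod_(i <- r | P i) f i x : K^o).
Proof.
move=> cf; elim: r => [|i r IHr].
  by under eq_fun do rewrite big_nil; move=> x; exact: cvg_cst.
case Pi: (P i); under eq_fun do rewrite big_cons Pi; last exact: IHr.
by apply: continuous_mul; [exact: cf|exact: IHr].
Qed.

Lemma continuous_normr (f : T -> K^o) :
  continuous f -> continuous (fun x => `|f x| : K^o).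
Proof.
move=> cf x; apply: (@continuous_comp _ _ _ f (fun y => `|y|)); first exact: cf.
exact: norm_continuous.
Qed.

Lemma continuous_nbhs_dist (f : T -> K^o) (x : T) (r : K) :
  continuous f -> 0 < r -> nbhs x [set y | `|f x - f y| < r].
Proof.
move=> cf r_gt0; have := cf x _ (nbhsx_ballx (f x) r r_gt0).
by rewrite -ball_normE.
Qed.

Lemma continuous_mx m n (f : T -> 'M[K^o]_(m, n)) :
  (forall i j, continuous (fun x => f x i j)) -> continuous f.
Proof.
move=> cf x A [P fP PA].
have : \forall y \near x, forall ij : 'I_m * 'I_n, P ij.1 ij.2 (f y ij.1 ij.2).
  by apply: filter_forall => -[i j] /=; exact: (cf i j x _ (fP i j)).
by apply: filterS => y Py; apply: PA => i j; exact: (Py (i, j)).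
Qed.

Lemma continuous_mulmx m n p (f : T -> 'M[K^o]_(m, n)) (g : T -> 'M[K^o]_(n, p)) :
    (forall i j, continuous (fun x => f x i j)) ->
    (forall i j, continuous (fun x => g x i j)) ->
  forall i j, continuous (fun x => (f x *m g x) i j : K^o).
Proof.
move=> cf cg i j; under eq_fun do rewrite mxE.
by apply: continuous_sum => k _; exact: continuous_mul.
Qed.

Lemma continuous_det n (f : T -> 'M[K^o]_n) :
    (forall i j, continuous (fun x => f x i j)) ->
  continuous (fun x => \det (f x) : K^o).
Proof.
move=> cf; apply: continuous_sum => s _; apply: continuous_mul.
  by move=> x; exact: cvg_cst.
exact: continuous_prod.
Qed.

End Continuity.

Lemma continuous_entry (K : numFieldType) m n i j :
  continuous (fun A : 'M[K^o]_(m, n) => A i j : K^o).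
Proof. exact: coord_continuous. Qed.

Lemma continuous_conj_entry (K : numFieldType) n (A : 'M[K]_n) i j :
  continuous (fun Q : 'M[K^o]_n => (Q *m A *m Q^T) i j : K^o).
Proof.
apply: (@continuous_mulmx K _ _ _ _ (fun Q : 'M[K^o]_n => Q *m A) (fun Q => Q^T)).
  apply: (@continuous_mulmx K _ _ _ _ (fun Q : 'M[K^o]_n => Q) (fun Q => A)).
    exact: continuous_entry.
  by move=> i0 j0; exact: (@cst_continuous _ K^o).
by move=> ? ?; under eq_fun do rewrite mxE; exact: continuous_entry.
Qed.

(** * Compact sets of complex matrices *)

Section ComplexCompactness.
Variable R : realType.
Local Notation C := R[i].

(** A square rather than a disk, because it is a continuous image of a product of two real
    segments. *)
Definition complex_square (b : R) : set C^o :=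
  [set z | `|complex.Re z| <= b /\ `|complex.Im z| <= b].

Lemma norm_le_complex_square (b : R) (z : C) :
  `|z| <= b%:C -> complex_square b z.
Proof.
rewrite normc_def lecR => zb; split; apply: le_trans zb;
  rewrite -sqrtr_sqr; apply: ler_wsqrtr; rewrite ?lerDl ?lerDr sqr_ge0 //.
Qed.

Lemma continuous_real_complex : continuous (fun x : R => x%:C : C^o).
Proof.
move=> x; apply/cvgrPdist_lt => e e_gt0.
have [e' eE] : exists e', e = e'%:C.
  by apply/complex_realP; rewrite gtr0_real.
have e'_gt0 : 0 < e' by rewrite -ltcR -eE.
near=> y; rewrite /= -raddfB /= normc_def /= expr0n /= addr0 sqrtr_sqr eE ltcR.
by near: y; apply: cvgr_dist_lt.
Unshelve. all: by end_near. Qed.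

Lemma compact_complex_square b : compact (complex_square b).
Proof.
pose I : set R := `[- b, b].
have -> : complex_square b =
    (fun p : R * R => (p.1)%:C + 'i%C * (p.2)%:C : C^o) @` (I `*` I).
  apply/seteqP; split => [z [zr zi]|_ [[x y] [/= Ix Iy] <-]].
    exists (complex.Re z, complex.Im z); last by rewrite /= -complexE.
    by split; rewrite /I /= in_itv /= -ler_norml.
  by move: Ix Iy; rewrite /I /= !in_itv /= -!ler_norml /complex_square /=; simpc.
apply: continuous_compact; last by apply: compact_setX; exact: segment_compact.
apply: continuous_subspaceT; apply: (@continuous_add C).
  move=> p; apply: (@continuous_comp _ _ _ fst (fun x : R => x%:C : C^o)).
    exact: cvg_fst.
  exact: continuous_real_complex.
apply: (@continuous_mul C); first exact: (@cst_continuous _ C^o).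
move=> p; apply: (@continuous_comp _ _ _ snd (fun x : R => x%:C : C^o)).
  exact: cvg_snd.
exact: continuous_real_complex.
Qed.

Lemma compact_mx_complex_square m n b :
  compact [set A : 'M[C^o]_(m, n) | forall i j, complex_square b (A i j)].
Proof.
have -> : [set A : 'M[C^o]_(m, n) | forall i j, complex_square b (A i j)] =
    (fun v : 'rV[C^o]_(m * n) => vec_mx v : 'M[C^o]_(m, n)) @`
      [set v : 'rV[C^o]_(m * n) | forall i, complex_square b (v ord0 i)].
  apply/seteqP; split => [A bA|_ [v bv <-] i j]; last by rewrite mxE; exact: bv.
  exists (mxvec A); last by rewrite mxvecK.
  by move=> k /=; case/mxvec_indexP: k => i j; rewrite mxvecE; exact: bA.
apply: continuous_compact; last first.
  exact: (@rV_compact C^o _ (fun=> complex_square b) (fun=> @compact_complex_square b)).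
apply: continuous_subspaceT; apply: continuous_mx => i j.
under eq_fun do rewrite mxE; exact: continuous_entry.
Qed.

Lemma hausdorff_mx m n : hausdorff_space 'M[C^o]_(m, n).
Proof. exact: norm_hausdorff. Qed.

(** Used twice: with the norm of the determinant, for a compact set containing the unitary matrices,
    and with the determinant, for a bounded part of the special linear group. *)
Lemma compact_bounded_level n (f : 'M[C^o]_n -> C^o) (b : R) (z : C^o) :
    continuous f ->
  compact [set A : 'M[C^o]_n | (forall i j, complex_square b (A i j)) /\ f A = z].
Proof.
move=> cf; apply: subclosed_compact (@compact_mx_complex_square n n b) _.
  rewrite -[X in closed X]/([set A : 'M[C^o]_n |
    forall i j, complex_square b (A i j)] `&` (f @^-1` [set z])).
  apply: closedI.
    by apply: compact_closed (@compact_mx_complex_square _ _ _); exact: hausdorff_mx.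
  apply: preimage_closed => [A _|]; first exact: cf.
  by apply: compact_closed (@compact_set1 _ _); exact: norm_hausdorff.
by move=> A [].
Qed.

(** The order of [C] being partial, no minimum is taken: the image of [D] is closed and misses 0,
    hence misses a ball of radius [e] around 0. *)
Lemma compact_pos_lower_bound (T : topologicalType) (D : set T) (f : T -> C^o) :
    compact D -> continuous f -> (forall x, D x -> 0 < f x :> C) ->
  exists2 c : C, 0 < c & forall x, D x -> c <= f x.
Proof.
move=> cD cf f_gt0.
have clD : closed (f @` D).
  apply: compact_closed; first exact: norm_hausdorff.
  by apply: continuous_compact cD; exact: continuous_subspaceT.
have : nbhs (0 : C^o) (~` (f @` D)).
  apply: open_nbhs_nbhs; split; first exact: closed_openC.
  by move=> [x Dx fx0]; have := f_gt0 x Dx; rewrite fx0 ltxx.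
move=> /nbhs_ballP[e /= e_gt0 eD]; exists e => // x Dx.
have f_pos := f_gt0 x Dx.
rewrite real_leNgt ?gtr0_real //; apply/negP => fe.
apply: (eD (f x)); last by exists x.
by rewrite -ball_normE /ball_ /= sub0r normrN gtr0_norm.
Qed.

End ComplexCompactness.

(** * The numerical criterion for six-by-six matrices *)

Section OneParameterSubgroup.
Variables (C : numFieldType) (m n : nat) (M : 'I_m -> 'M[C]_n).
Variables (Q : 'M[C]_n) (l : 'I_n -> int).
Hypotheses (uQ : Q \in unitmx) (sum_l : \sum_i l i = 0).

(** The one-parameter subgroup with weights [l] that is diagonal in the frame formed by the rows of
    [Q]. *)
Definition torus_elt (t : C) : 'M[C]_n :=
  invmx Q *m diag_mx (\row_i t ^ l i) *m Q.

Lemma det_torus_elt t : t != 0 -> \det (torus_elt t) = 1.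
Proof.
move=> t0; rewrite !det_mulmx det_diag mulrAC -det_mulmx (mulVmx uQ) det1 mul1r.
under eq_bigr do rewrite mxE.
suff -> : \prod_i t ^ l i = t ^ (\sum_i l i) by rewrite sum_l expr0z.
elim/big_rec2: _ => [|i y1 y2 _ ->]; first by rewrite expr0z.
by rewrite expfzDr.
Qed.

(** The diagonal entry [t^-1] determines [t]; this makes the stabilizer of the limit infinite in
    case (2). *)
Lemma torus_elt_inj i0 : l i0 = -1 -> injective torus_elt.
Proof.
move=> l0 t t' /(congr1 (fun X => Q *m X *m invmx Q)).
rewrite /torus_elt -!mulmxA (mulmxV uQ) !mulmx1 !(mulKVmx uQ).
move=> /matrixP/(_ i0 i0); rewrite !mxE l0 eqxx !mulr1n.
exact: invr_inj.
Qed.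

Hypothesis weights : forall k i j, l i + l j < 0 -> (Q *m M k *m Q^T) i j = 0.

(* The polynomial extension to [t = 0] of [t |-> torus_elt t . M]. *)
Definition torus_path (t : C) (k : 'I_m) : 'M[C]_n :=
  invmx Q *m (\matrix_(i, j) (t ^+ absz (l i + l j) * (Q *m M k *m Q^T) i j))
    *m (invmx Q)^T.

Lemma continuous_torus_path k i j :
  continuous (fun t : C^o => torus_path t k i j : C^o).
Proof.
have cst (a b : 'I_n) (N : 'M[C]_n) : continuous (fun _ : C^o => N a b : C^o).
  exact: (@cst_continuous _ C^o).
apply: (@continuous_mulmx C) => // a b.
apply: (@continuous_mulmx C) => // {}a {}b.
under eq_fun do rewrite mxE; apply: (@continuous_mul C) => //.
under eq_fun do rewrite -[absz _]card_ord -prodr_const.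
by apply: (@continuous_prod C) => _ _ x; exact: cvg_id.
Qed.

Lemma conj_congr_invmx (N : 'M[C]_n) t :
  torus_elt t *m (invmx Q *m N *m (invmx Q)^T) *m (torus_elt t)^T =
  invmx Q *m (\matrix_(i, j) (t ^ l i * t ^ l j * N i j)) *m (invmx Q)^T.
Proof.
rewrite /torus_elt !trmx_mul tr_diag_mx !mulmxA (mulmxK uQ).
rewrite -!mulmxA (mulmxA (invmx Q)^T) -trmx_mul (mulmxV uQ) trmx1 mul1mx.
rewrite !mulmxA; congr (_ *m _); rewrite -!mulmxA; congr (_ *m _).
rewrite mulmxA; apply/matrixP => i j.
by rewrite mul_mx_diag mul_diag_mx !mxE mulrAC.
Qed.

Lemma torus_pathE t k : t != 0 ->
  torus_path t k = torus_elt t *m M k *m (torus_elt t)^T.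
Proof.
move=> t0; have -> : M k = invmx Q *m (Q *m M k *m Q^T) *m (invmx Q)^T.
  by rewrite !mulmxA (mulVmx uQ) mul1mx -mulmxA -trmx_mul (mulVmx uQ) trmx1 mulmx1.
rewrite conj_congr_invmx; congr (_ *m _ *m _); apply/matrixP => i j.
rewrite !mxE -expfzDr //.
(* Entries of negative weight vanish by [weights]; on the others [absz] leaves the exponent
   unchanged. *)
have [ge0|lt0] := leP 0 (l i + l j); last first.
  by have := weights k lt0; rewrite mxE => ->; rewrite !mulr0.
by rewrite -{2}(gez0_abs ge0).
Qed.

(** Since [0 ^+ 0 = 1], exactly the entries with [l i + l j = 0] survive at 0, and the torus acts
    trivially on them. *)
Lemma torus_path0_fixed t k : t != 0 ->
  torus_elt t *m torus_path 0 k *m (torus_elt t)^T = torus_path 0 k.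
Proof.
move=> t0; rewrite conj_congr_invmx; congr (_ *m _ *m _); apply/matrixP => i j.
rewrite !mxE -expfzDr // expr0n absz_eq0; have [->|] := eqVneq.
  by rewrite expr0z mul1r.
by rewrite mul0r mulr0.
Qed.

Lemma torus_path0_eq0 k :
    (forall k i j, l i + l j <= 0 -> (Q *m M k *m Q^T) i j = 0) ->
  torus_path 0 k = 0.
Proof.
move=> strict; rewrite /torus_path (_ : (\matrix_(_, _) _) = 0) ?mulmx0 ?mul0mx //.
apply/matrixP => i j; rewrite !mxE expr0n absz_eq0; have [l0|] := eqVneq.
  by have := strict k i j; rewrite l0 lexx mxE => ->; rewrite ?mulr0.
by rewrite mul0r.
Qed.

End OneParameterSubgroup.

(** * Flag patterns, lower bounds on orbits and destabilizing weights *)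

Section MatrixCriterion.
Variables (R : realType) (m : nat) (M : 'I_m -> 'M[R[i]]_6).
Local Notation C := R[i].

(* Indices start at 0: this is [1 <= i <= s], [i < j <= t - s] in 1-based terms. *)
Definition flag_pattern (t s : nat) (ij : 'I_6 * 'I_6) : bool :=
  [&& (ij.1 < s)%N, (ij.1 < ij.2)%N & (ij.2 < t - s)%N].

Definition mx_flagged (t : nat) : Prop :=
  exists2 Q : 'M[C]_6, Q \in unitmx & exists2 s : nat, (1 <= s <= 3)%N &
    forall k ij, flag_pattern t s ij -> (Q *m M k *m Q^T) ij.1 ij.2 = 0.

Definition pattern_norm (t s : nat) (Q : 'M[C^o]_6) : C^o :=
  \sum_k \sum_(ij | flag_pattern t s ij) `|(Q *m M k *m Q^T) ij.1 ij.2|.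

Lemma continuous_pattern_norm t s : continuous (pattern_norm t s).
Proof.
apply: continuous_sum => k _; apply: continuous_sum => ij _.
by apply: continuous_normr; exact: continuous_conj_entry.
Qed.

Lemma pattern_norm_gt0 t s (Q : 'M[C]_6) : ~ mx_flagged t -> (1 <= s <= 3)%N ->
  Q \in unitmx -> 0 < pattern_norm t s Q :> C.
Proof.
move=> nflag s13 uQ; rewrite lt_neqAle; apply/andP; split; last first.
  by apply: sumr_ge0 => k _; apply: sumr_ge0.
apply/eqP => /esym pn0; apply: nflag; exists Q => //; exists s => // k ij Dij.
have ge0 k' : true -> 0 <= \sum_(ij | flag_pattern t s ij)
    `|(Q *m M k' *m Q^T) ij.1 ij.2| by move=> _; apply: sumr_ge0.
have /psumr_eq0P := psumr_eq0P ge0 pn0 (i := k) isT.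
by move=> /(_ (fun _ _ => normr_ge0 _) ij Dij)/eqP; rewrite normr_eq0 => /eqP.
Qed.

(** For each [s] the pattern norm is continuous and positive on a compact set, hence bounded below;
    the smallest of the three bounds serves every [s]. *)
Lemma pattern_norm_gap t : ~ mx_flagged t ->
  exists2 c : C, 0 < c & forall s Q, (1 <= s <= 3)%N -> Q \is unitarymx ->
    c <= pattern_norm t s Q.
Proof.
move=> nflag.
(* A compact set of invertible matrices containing the unitary ones, whose
   closedness does not involve complex conjugation. *)
pose D := [set Q : 'M[C^o]_6 | (forall i j, complex_square 1 (Q i j)) /\
  `|\det Q| = 1 :> C^o].
have cD : compact D.
  apply: compact_bounded_level; apply: continuous_normr.
  by apply: continuous_det; exact: continuous_entry.
have gap s : (1 <= s <= 3)%N ->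
    exists2 c : C, 0 < c & forall Q, D Q -> c <= pattern_norm t s Q.
  move=> s13; apply: compact_pos_lower_bound => //.
    exact: continuous_pattern_norm.
  move=> Q [_ dQ]; apply: pattern_norm_gt0 => //.
  by rewrite unitmxE unitfE -normr_eq0 dQ oner_eq0.
have unitaryD Q : Q \is unitarymx -> D Q.
  move=> uQ; split; last exact: norm_det_unitarymx.
  by move=> i j; apply: norm_le_complex_square; rewrite norm_unitarymx_le1.
have min2 (x y : C) : 0 < x -> 0 < y -> exists z, [/\ 0 < z, z <= x & z <= y].
  move=> x0 y0; have [xy|yx] := real_leP (gtr0_real x0) (gtr0_real y0).
    by exists x.
  by exists y; rewrite ltW.
have [//|c1 c1_gt0 c1P] := gap 1%N.
have [//|c2 c2_gt0 c2P] := gap 2%N.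
have [//|c3 c3_gt0 c3P] := gap 3%N.
have [z [z_gt0 z1 z2]] := min2 _ _ c1_gt0 c2_gt0.
have [c [c_gt0 cz c3']] := min2 _ _ z_gt0 c3_gt0.
exists c => // -[|[|[|[|s]]]] // Q _ /unitaryD DQ.
- by apply: le_trans (c1P _ DQ); apply: le_trans cz z1.
- by apply: le_trans (c2P _ DQ); apply: le_trans cz z2.
- by apply: le_trans (c3P _ DQ).
Qed.

Definition orbit_norm (G : 'M[C]_6) : C := \sum_k l1norm (G *m M k *m G^T).

Lemma orbit_norm_gap : ~ mx_flagged 7 ->
  exists2 c : C, 0 < c & forall G, \det G = 1 -> c <= orbit_norm G.
Proof.
move=> /pattern_norm_gap[c c_gt0 cP].
(* The 36 is the factor [n * n] of [singular_pattern_bound]. *)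
exists (c / 36%:R); first by rewrite divr_gt0 // ltr0n.
move=> G dG; have dG0 : \det G != 0 by rewrite dG oner_neq0.
have [P [Q [d [uP uQ d_gt0 d_mono PGE]]]] := svd_sorted dG0.
have prod_d := prod_singular_values dG uP uQ d_gt0 PGE.
have [s s13 ds] := exists_outer_pair_ge1 d_gt0 prod_d.
rewrite ler_pdivrMr ?ltr0n // mulr_natr -[c]mul1r.
apply: (singular_pattern_bound uP d_gt0 PGE (D := flag_pattern 7 s)) => //.
  (* A pattern position has [i <= s.-1] and [j <= 6 - s], so monotonicity of [d] bounds [d_i d_j]
     below by the outer pair product. *)
  move=> [i j] /and3P[/= i_s ij js]; apply: le_trans ds _.
  have d_ge0 k := ltW (d_gt0 k).
  by apply: ler_pM => //; apply: d_mono; rewrite inordK; move: s13 i_s js; lia.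
exact: cP.
Qed.

Lemma orbit_norm_proper (b : C) : 0 <= b -> ~ mx_flagged 6 ->
  exists b' : R, forall G, \det G = 1 -> orbit_norm G <= b ->
    forall i j, `|G i j| <= b'%:C.
Proof.
move=> b_ge0 /pattern_norm_gap[c c_gt0 cP].
(* The quotient bounds the pair products; the added 1 gives the lower bound required by
   [largest_le_of_inner_pairs]. *)
pose q : C := 1 + (b *+ 36) / c.
have q_ge1 : 1 <= q by rewrite lerDl divr_ge0 ?mulrn_wge0 // ltW.
have q_ge0 : 0 <= q := le_trans ler01 q_ge1.
(* Each singular value is at most [q ^+ 4], and [norm_svd_le] multiplies this bound by 6. *)
have [b' b'E] : exists b', q ^+ 4 *+ 6 = b'%:C.
  by apply/complex_realP; rewrite ger0_real // mulrn_wge0 // exprn_ge0.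
exists b' => G dG Gb i j; rewrite -b'E.
have dG0 : \det G != 0 by rewrite dG oner_neq0.
have [P [Q [d [uP uQ d_gt0 d_mono PGE]]]] := svd_sorted dG0.
have prod_d := prod_singular_values dG uP uQ d_gt0 PGE.
have d_ge0 k := ltW (d_gt0 k).
have pair_le (s k l : nat) : (1 <= s <= 3)%N -> (k < 6)%N -> (l < 6)%N ->
    (forall ij, flag_pattern 6 s ij -> (ij.1 <= k)%N && (ij.2 <= l)%N) ->
    d 0 (inord k) * d 0 (inord l) <= q.
  move=> s13 k6 l6 patP; apply: (@le_trans _ _ ((b *+ 36) / c)); last first.
    by rewrite lerDr ler01.
  rewrite ler_pdivlMr //; apply: (le_trans (y := orbit_norm G *+ 36)); last first.
    exact: ler_wMn2r.
  apply: (singular_pattern_bound uP d_gt0 PGE (D := flag_pattern 6 s)).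
  - exact: mulr_ge0.
  - move=> [a a'] /patP/andP[/= ak a'l].
    by apply: ler_pM => //; apply: d_mono; rewrite inordK.
  - exact: cP.
apply: (norm_svd_le uP uQ d_gt0 PGE).
apply: (largest_le_of_inner_pairs d_gt0 prod_d d_mono q_ge1).
(* The extreme positions of the three patterns are (0,4), (1,3) and (1,2): for [s = 3], [i < j < 3]
   forces [i <= 1]. *)
- by apply: (pair_le 1%N) => // -[a a'] /and3P[/=]; lia.
- by apply: (pair_le 2%N) => // -[a a'] /and3P[/=]; lia.
- by apply: (pair_le 3%N) => // -[a a'] /and3P[/=]; lia.
Qed.

Hypothesis skewM : forall k, (M k)^T = - M k.

Lemma skew_conj_entry (Q : 'M[C]_6) k i j :
  (Q *m M k *m Q^T) j i = - (Q *m M k *m Q^T) i j.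
Proof.
have -> : (Q *m M k *m Q^T) j i = (Q *m M k *m Q^T)^T i j by rewrite [RHS]mxE.
by rewrite !trmx_mul trmxK skewM mulNmx mulmxN mulmxA mxE.
Qed.

(** The pattern lists only positions above the diagonal; skew-symmetry adds the transposed positions
    and the diagonal. *)
Lemma flag_pattern_vanish t s (Q : 'M[C]_6) :
    (forall k ij, flag_pattern t s ij -> (Q *m M k *m Q^T) ij.1 ij.2 = 0) ->
  forall k i j, [|| i == j, flag_pattern t s (i, j) | flag_pattern t s (j, i)] ->
    (Q *m M k *m Q^T) i j = 0.
Proof.
move=> patP k i j /or3P[/eqP<-|/(patP k)//|/(patP k)/= N0].
  have /eqP := skew_conj_entry Q k i i.
  by rewrite -addr_eq0 -mulr2n mulrn_eq0 => /eqP.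
by rewrite skew_conj_entry N0 oppr0.
Qed.

(* Off the pattern of [s], with [t = 7] (resp. [t = 6] below), every [l i + l j]
   with [i != j] is positive (resp. nonnegative). *)
Definition strict_weight (s : nat) (i : 'I_6) : int :=
  nth 0 (nth [::] [:: [:: -5; 1; 1; 1; 1; 1]; [:: -4; -4; 1; 1; 1; 5];
                      [:: -1; -1; -1; -1; 2; 2]] s.-1) i.

Definition weak_weight (s : nat) (i : 'I_6) : int :=
  nth 0 (nth [::] [:: [:: -1; 0; 0; 0; 0; 1]; [:: -1; -1; 0; 0; 1; 1];
                      [:: -1; -1; -1; 1; 1; 1]] s.-1) i.

Lemma strict_destabilizing : mx_flagged 7 ->
  exists (Q : 'M[C]_6) (l : 'I_6 -> int), [/\ Q \in unitmx, \sum_i l i = 0 &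
    forall k i j, l i + l j <= 0 -> (Q *m M k *m Q^T) i j = 0].
Proof.
move=> [Q uQ [s s13 patP]]; exists Q, (strict_weight s); split => //.
  by case: s s13 {patP} => [|[|[|[|s]]]] // _; rewrite !big_ord_recl big_ord0.
move=> k i j lij; apply: (flag_pattern_vanish patP); move: s13 i j lij.
by case: s {patP} => [|[|[|[|s]]]] // _;
  case=> [] [|[|[|[|[|[|i]]]]]] // ?; case=> [] [|[|[|[|[|[|j]]]]]].
Qed.

Lemma weak_destabilizing : mx_flagged 6 ->
  exists (Q : 'M[C]_6) (l : 'I_6 -> int),
    [/\ Q \in unitmx, \sum_i l i = 0, l ord0 = -1 &
    forall k i j, l i + l j < 0 -> (Q *m M k *m Q^T) i j = 0].
Proof.
move=> [Q uQ [s s13 patP]]; exists Q, (weak_weight s); split => //.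
- by case: s s13 {patP} => [|[|[|[|s]]]] // _; rewrite !big_ord_recl big_ord0.
- by case: s s13 {patP} => [|[|[|[|s]]]].
move=> k i j lij; apply: (flag_pattern_vanish patP); move: s13 i j lij.
by case: s {patP} => [|[|[|[|s]]]] // _;
  case=> [] [|[|[|[|[|[|i]]]]]] // ?; case=> [] [|[|[|[|[|[|j]]]]]].
Qed.

End MatrixCriterion.

(** * The stabilizer of an unflagged system *)

(** Bases of [U], of a complement of [U] in [U'] and of a complement of [U'] are concatenated. *)
Lemma adapted_basis (F : fieldType) (W : vectType F) (n : nat)
    (U U' : {vspace W}) : \dim {:W} = n -> (U <= U')%VS ->
  exists e : n.-tuple W, basis_of {:W} e /\
    forall i : 'I_n, ((i < \dim U)%N -> tnth e i \in U) /\
                     ((i < \dim U')%N -> tnth e i \in U').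
Proof.
move=> <- UU'.
pose s1 := vbasis U : seq W; pose s2 := vbasis (U' :\: U)%VS : seq W.
pose s3 := vbasis (U'^C)%VS : seq W.
have b12 : basis_of U' (s1 ++ s2).
  have -> : U' = (U + (U' :\: U))%VS by rewrite addvC addv_diff; apply/esym/addv_idPl.
  by apply: cat_basis; rewrite ?vbasisP //; apply/directv_addP; rewrite capvC capv_diff.
have b123 : basis_of {:W} ((s1 ++ s2) ++ s3).
  rewrite -(addv_complf U').
  by apply: cat_basis; rewrite ?vbasisP //; apply/directv_addP; rewrite capv_compl.
have szb V (X : seq W) : basis_of V X -> size X = \dim V.
  by move=> bX; rewrite (@size_basis _ _ _ _ (in_tuple X)).
have sz : size ((s1 ++ s2) ++ s3) == \dim {:W} by rewrite (szb _ _ b123).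
exists (Tuple sz); split=> // i.
have sz12 : size (s1 ++ s2) = \dim U' := szb _ _ b12.
have sz1 : size s1 = \dim U by rewrite size_tuple.
rewrite (tnth_nth 0) /=; split=> ilt.
  have i12 : (i < size (s1 ++ s2))%N by rewrite sz12 (leq_trans ilt) ?dimvS.
  by rewrite nth_cat i12 nth_cat sz1 ilt vbasis_mem // mem_nth // sz1.
by rewrite nth_cat sz12 ilt (basis_mem b12) // mem_nth // sz12.
Qed.

(** The matrix [B] of [f] restricted to [K] has a row eigenvector, whose entries are the coordinates
    of [v]. *)
Lemma eigenvector_in (C : numClosedFieldType) (W : vectType C) (f : 'End(W))
    (K : {vspace W}) : K != 0%VS -> (f @: K <= K)%VS ->
  exists a v, [/\ v \in K, v != 0 & f v = a *: v].
Proof.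
rewrite -dimv_eq0 -lt0n => dK fK.
pose e := vbasis K.
pose B := \matrix_(i < \dim K, j < \dim K) coord e j (f e`_i).
have [a /eigenvalueP[u uB u0]] := eigenvalue_closed B dK.
exists a, (\sum_i u 0 i *: e`_i); split.
- by apply: memv_suml => i _; rewrite memvZ // vbasis_mem // mem_nth // size_tuple.
- apply: contra u0 => /eqP v0; apply/eqP/rowP => i; rewrite mxE.
  exact: (elimT freeP (basis_free (vbasisP K)) (u 0) v0 i).
- have fe (i : 'I_(\dim K)) : f e`_i = \sum_j B i j *: e`_j.
    have feK : f e`_i \in K.
      by apply/(subvP fK)/memv_img; rewrite vbasis_mem // mem_nth // size_tuple.
    by rewrite {1}(coord_vbasis feK); apply: eq_bigr => j _; rewrite mxE.
  rewrite linear_sum; under eq_bigr do rewrite linearZ /= fe scaler_sumr.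
  rewrite exchange_big scaler_sumr; apply: eq_bigr => j _ /=.
  under eq_bigr do rewrite scalerA; rewrite -scaler_suml scalerA; congr (_ *: _).
  by have /rowP/(_ j) := uB; rewrite !mxE.
Qed.

Section Invariance.
Variables (R : realType) (W : vectType R[i]) (A : {vspace bilform W}).

Definition flagged (t : nat) : Prop :=
  exists e : 6.-tuple W, basis_of {:W} e /\
    exists s : nat, (1 <= s <= 3)%N /\
      forall w, w \in A -> forall i j : 'I_6, (i < s)%N -> (i < j)%N ->
        (j < t - s)%N -> w (tnth e i) (tnth e j) = 0.

Hypothesis dimW : \dim {:W} = 6%N.
Hypothesis skewA : forall w, w \in A -> skew_symmetric w.

(** The coordinate-free form of the pattern, read off in a basis adapted to [U] inside [U']. *)
Lemma flagged_subspaces (t s : nat) (U U' : {vspace W}) :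
    (1 <= s <= 3)%N -> (U <= U')%VS -> (s <= \dim U)%N -> (t - s <= \dim U')%N ->
    (forall w x y, w \in A -> x \in U -> y \in U' -> w x y = 0) ->
  flagged t.
Proof.
move=> s13 UU' sU sU' perp; have [e [be eUU']] := adapted_basis dimW UU'.
exists e; split=> //; exists s; split=> // w wA i j si ij js.
apply: perp => //; first by apply: (eUU' i).1; exact: leq_trans si sU.
by apply: (eUU' j).2; exact: leq_trans js sU'.
Qed.

Variable g : 'End(W).
Hypothesis g_inj : lker g = 0%VS.
Hypothesis g_inv : forall w x y, w \in A -> w (g x) (g y) = w x y.
Hypothesis no_flag : ~ flagged 6.

Let h (m : R[i]) : 'End(W) := g - m *: \1%VF.
Let hE m x : h m x = g x - m *: x.
Proof. by rewrite add_lfunE opp_lfunE scale_lfunE id_lfunE. Qed.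

Let E m := lker (h m).
Let I m := limg (h m).

Let memE m x : reflect (g x = m *: x) (x \in E m).
Proof. by rewrite memv_ker hE subr_eq0; exact: eqP. Qed.

Let dimEI m : (\dim (E m) + \dim (I m) = 6)%N.
Proof. by rewrite -dimW -(limg_ker_dim (h m) {:W}) capfv. Qed.

Let eigen_neq0 m : E m != 0%VS -> m != 0.
Proof.
apply: contraNneq => ->; rewrite -subv0 -g_inj; apply/subvP => x.
by move=> /memE gx; rewrite memv_ker gx scale0r.
Qed.

(** For [x = g z - m z] and [y = m (g y)], invariance gives
    [w (g z) y = m w (g z) (g y) = m w z y]. *)
Let perpEI m w x y : w \in A -> m != 0 -> x \in I m -> y \in E m^-1 -> w x y = 0.
Proof.
move=> wA m0 /memv_imgP[z _ ->]; move=> /memE gy.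
rewrite hE linearB add_lfunE opp_lfunE linearZ scale_lfunE.
have {1}-> : y = m *: g y by rewrite gy scalerA mulfV // scale1r.
by rewrite linearZ /= g_inv // subrr.
Qed.

Let disjE m n : m != n -> (E m :&: E n = 0)%VS.
Proof.
move=> mn; apply/eqP; rewrite -subv0; apply/subvP => x; rewrite memv_cap.
move=> /andP[/memE gx /memE/eqP]; rewrite gx -subr_eq0 -scalerBl scaler_eq0 subr_eq0.
by rewrite (negPf mn) memv0.
Qed.

Let E_sub_I m n : m != n -> (E n <= I m)%VS.
Proof.
move=> mn; apply/subvP => x; move=> /memE gx.
apply/memv_imgP; exists ((n - m)^-1 *: x); first exact: memvf.
rewrite linearZ /= hE gx -scalerBl scalerA mulVf ?scale1r //.
by rewrite subr_eq0 eq_sym.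
Qed.

(* [E m^-1] lies in its orthogonal [I m], whose codimension is [\dim (E m)]. *)
Let smaller_eigenspace m : E m != 0%VS -> m != m^-1 ->
  (\dim (E m^-1) < \dim (E m))%N.
Proof.
move=> Em mm; rewrite ltnNge; apply/negP => dle; apply: no_flag.
have dE := dimv_disjoint_sum (disjE mm).
have : (\dim (E m + E m^-1) <= 6)%N by rewrite -dimW dimvS ?subvf.
rewrite dE => d6.
apply: (@flagged_subspaces 6 (\dim (E m)) (E m^-1) (I m)) => //.
(* Here [s] is the smaller of the dimensions of two independent eigenspaces in dimension 6, so it is
   at most 3. *)
- rewrite lt0n dimv_eq0 Em /=; move: d6 dle; lia.
- exact: E_sub_I.
- by rewrite -(dimEI m) addKn.
- move=> w x y wA xE yI.
  by rewrite (skewA wA x y) (perpEI wA (eigen_neq0 Em) yI xE) oppr0.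
Qed.

(** If both [m] and [m^-1] were eigenvalues, [smaller_eigenspace] would give strict inequalities in
    both directions. If only [m] is one, [I m^-1] is all of [W], so an eigenvector for [m] lies in
    the kernel of every form, a pattern with [s = 1]. *)
Let self_inverse_eigenvalue m : E m != 0%VS -> m = m^-1.
Proof.
move=> Em; apply/eqP/negPn/negP => mm.
have := smaller_eigenspace Em mm.
have [Em1 _|Em1] := eqVneq (E m^-1) 0%VS; last first.
  have := @smaller_eigenspace m^-1 Em1; rewrite invrK eq_sym => /(_ mm).
  by move=> /ltnW; rewrite leqNgt => /negP.
apply: no_flag; apply: (@flagged_subspaces 6 1 (E m) fullv) => //.
- exact: subvf.
- by rewrite lt0n dimv_eq0.
- by rewrite dimW.
- have If : I m^-1 = fullv.
    apply/eqP; rewrite eqEdim subvf dimW /=.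
    by have := dimEI m^-1; rewrite Em1 dimv0 add0n => ->.
  have m1 : m^-1 != 0 by rewrite invr_eq0 eigen_neq0.
  move=> w x y wA xE _; rewrite (skewA wA x y).
  have yI : y \in I m^-1 by rewrite If memvf.
  have xE' : x \in E m^-1^-1 by rewrite invrK.
  by rewrite (perpEI wA m1 yI xE') oppr0.
Qed.

(* [E m :&: I m] is orthogonal to [E m + I m], and their dimensions add up to 6. *)
Let semisimple_eigenvalue m : E m != 0%VS -> (E m :&: I m = 0)%VS.
Proof.
move=> Em; apply/eqP/negPn/negP => EI; apply: no_flag.
have m0 := eigen_neq0 Em; have mm := self_inverse_eigenvalue Em.
have dEI := dimv_sum_cap (E m) (I m); rewrite dimEI in dEI.
have d1 : (\dim (E m :&: I m) <= \dim (E m))%N by rewrite dimvS ?capvSl.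
have d2 : (\dim (E m :&: I m) <= \dim (I m))%N by rewrite dimvS ?capvSr.
apply: (@flagged_subspaces 6 (\dim (E m :&: I m)) (E m :&: I m) (E m + I m)) => //.
- rewrite lt0n dimv_eq0 EI /=; have := dimEI m; move: d1 d2; lia.
- by apply: subv_trans (capvSl _ _) (addvSl _ _).
- by rewrite -dEI addnK.
- move=> w x y wA; rewrite memv_cap => /andP[xE xI] /memv_addP[y1 y1E [y2 y2I ->]].
  have y1E' : y1 \in E m^-1 by rewrite -mm.
  have xE' : x \in E m^-1 by rewrite -mm.
  rewrite linearD /= (perpEI wA m0 xI y1E') add0r (skewA wA x y2).
  by rewrite (perpEI wA m0 y2I xE') oppr0.
Qed.

(** Were the image of [g^2 - 1] nonzero, it would be [g]-stable and contain an eigenvector; that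
    vector would lie in [E m] and [I m] at once, against [semisimple_eigenvalue]. *)
Lemma invariance_involutive : (g \o g = \1)%VF.
Proof.
pose q := (g \o g - \1)%VF.
have qE x : q x = g (g x) - x by rewrite add_lfunE opp_lfunE comp_lfunE id_lfunE.
apply/eqP/negPn/negP => gg1.
have limq : limg q != 0%VS.
  apply: contra gg1 => /eqP q0; apply/eqP/lfunP => x.
  have : q x \in limg q by rewrite memv_img ?memvf.
  by rewrite q0 memv0 qE subr_eq0 comp_lfunE id_lfunE => /eqP.
have stable_q : (g @: limg q <= limg q)%VS.
  apply/subvP => _ /memv_imgP[_ /memv_imgP[x _ ->] ->].
  by rewrite qE linearB -qE memv_img ?memvf.
have [m [v [/memv_imgP[x _ vE] v0 gv]]] := eigenvector_in limq stable_q.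
have vEm : v \in E m by apply/memE.
have Em : E m != 0%VS by apply: contraNneq v0 => Em; rewrite -memv0 -Em.
have mm : m * m = 1.
  by rewrite {2}(self_inverse_eigenvalue Em) mulfV // eigen_neq0.
suff vIm : v \in I m.
  by move: v0; rewrite -memv0 -(semisimple_eigenvalue Em) memv_cap vEm vIm.
(* The witness comes from [g^2 - 1 = (g - m)(g + m)], valid because [m * m = 1]. *)
apply/memv_imgP; exists (g x + m *: x); first exact: memvf.
rewrite vE qE hE linearD linearZ /= scalerDr scalerA mm scale1r.
by rewrite opprD addrA addrK.
Qed.

End Invariance.

(** * Finiteness of commuting sets of involutions *)

Lemma diagonalizable_involution (F : fieldType) n (A : 'M[F]_n.+1) :
  2%:R != 0 :> F -> A *m A = 1%:M -> diagonalizable A.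
Proof.
move=> two_neq0 AA; apply/diagonalizableP; exists [:: 1; -1].
  by rewrite /= inE andbT -subr_eq0 opprK -(natrD _ 1 1).
apply: mxminpoly_min; rewrite !big_cons big_nil mulr1 rmorphM !rmorphB /=.
rewrite horner_mx_X !horner_mx_C (_ : (-1)%:M = - 1%:M) ?raddfN // opprK.
by rewrite -[_ * _]/(_ *m _) mulmxBl !mulmxDr AA !mulmx1 mul1mx [A + _]addrC subrr.
Qed.

(** An infinite set would contain a finite subset [B] with more than [2 ^ n.+1] elements.
    Simultaneous diagonalization turns these into distinct diagonal matrices with entries 1 or -1,
    and there are too few of those. *)
Lemma finite_commuting_involutions (F : fieldType) n (S : set 'M[F]_n.+1) :
    2%:R != 0 :> F -> (forall A, S A -> A *m A = 1%:M) ->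
    (forall A B, S A -> S B -> A *m B = B *m A) ->
  finite_set S.
Proof.
move=> two_neq0 invS comS; apply: contrapT => /infinite_set_fset.
move=> /(_ (2 ^ n.+1).+1)[B BS cardB].
have BSP A : A \in (B : seq _) -> S A by move=> AB; apply: BS.
have [P uP] : codiagonalizable (B : seq _).
  apply/codiagonalizableP; split => [A A' /BSP SA /BSP SA'|A /BSP SA].
    exact: comS.
  exact: diagonalizable_involution (invS A SA).
move=> /allP/= diagB.
pose D A := P *m A *m invmx P.
have diagD A : A \in (B : seq _) -> is_diag_mx (D A).
  by move=> /diagB /is_diag_mxP dA; apply/is_diag_mxP => i j /dA; rewrite conjumx.
have sqD A i : A \in (B : seq _) -> D A i i * D A i i = 1.
  move=> AB; have /is_diag_mxP dA := diagD A AB.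
  have : D A *m D A = 1%:M.
    rewrite /D !mulmxA mulmxKV // -(mulmxA P A A) (invS _ (BSP _ AB)) mulmx1.
    by rewrite mulmxV.
  move=> /matrixP/(_ i i); rewrite [LHS]mxE [RHS]mxE eqxx (bigD1 i) //=.
  rewrite big1 ?addr0 // => j ji.
  by rewrite dA ?mul0r // eq_sym.
(* Recording which diagonal entries equal 1 determines [D A], since the others equal -1. *)
pose code A := [ffun i => D A i i == 1].
have code_inj : {in (B : seq _) &, injective code}.
  move=> A A' AB A'B /ffunP eqc.
  have DD : D A = D A'.
    apply/matrixP => i j; have [<-|ij] := eqVneq i j; last first.
      by rewrite (is_diag_mxP (diagD _ AB)) // (is_diag_mxP (diagD _ A'B)).
    have := eqc i; rewrite !ffunE => eqi.
    have sq_cases C : C \in (B : seq _) -> (D C i i == 1) || (D C i i == -1).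
      by move=> CB; rewrite -eqf_sqr expr1n expr2 sqD.
    move: (sq_cases _ AB) (sq_cases _ A'B); rewrite eqi.
    by case: (D A' i i =P 1) eqi => [-> /eqP->|_ _ /= /eqP-> /eqP->].
  have invD C : C = invmx P *m D C *m P by rewrite /D !mulmxA mulVmx // mul1mx mulmxKV.
  by rewrite (invD A) DD -invD.
have : uniq (map code B) by rewrite map_inj_in_uniq ?fset_uniq.
move=> /card_uniqP cardE.
have := max_card (mem (map code B)); rewrite cardE size_map.
rewrite card_ffun card_bool card_ord leqNgt.
by rewrite cardB.
Qed.

(** * Coordinates on the forms and on Hom(V, bilform W) *)

Section Frames.
Variables (F : fieldType) (W : vectType F) (n : nat) (e : n.-tuple W).

Definition coords_of (v : W) : 'rV[F]_n := \row_i coord e i v.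
Definition of_coords (u : 'rV[F]_n) : W := \sum_i u 0 i *: e`_i.

Lemma coords_of_linear : linear coords_of.
Proof. by move=> a u v; apply/rowP => i; rewrite !mxE linearP. Qed.

HB.instance Definition _ := GRing.isSemilinear.Build F _ _ _ coords_of
  (GRing.semilinear_linear coords_of_linear).

Lemma of_coords_linear : linear of_coords.
Proof.
move=> a u v; rewrite /of_coords scaler_sumr -big_split /=.
by apply: eq_bigr => i _; rewrite !mxE scalerDl scalerA.
Qed.

HB.instance Definition _ := GRing.isSemilinear.Build F _ _ _ of_coords
  (GRing.semilinear_linear of_coords_linear).

(** Matrices act on row vectors, so composition becomes the product in reverse order. The free size
    [n] allows matrices of size literally 6. *)
Definition lfun_mx (g : 'End(W)) : 'M[F]_n := \matrix_i coords_of (g e`_i).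

Definition mx_lfun (G : 'M[F]_n) : 'End(W) :=
  linfun (of_coords \o mulmxr G \o coords_of).

Definition frame_mx (e' : n.-tuple W) : 'M[F]_n := \matrix_i coords_of e'`_i.

Definition mx_frame (Q : 'M[F]_n) : n.-tuple W :=
  [tuple of_coords (row i Q) | i < n].

Hypothesis be : basis_of {:W} e.

Lemma coords_ofK : cancel coords_of of_coords.
Proof.
move=> v; rewrite [RHS](coord_basis be (memvf v)).
by apply: eq_bigr => i _; rewrite mxE.
Qed.

Lemma of_coordsK : cancel of_coords coords_of.
Proof.
move=> u; apply/rowP => i; rewrite mxE coord_sum_free //; exact: basis_free be.
Qed.

Lemma coords_of_app (g : 'End(W)) v : coords_of (g v) = coords_of v *m lfun_mx g.
Proof.
rewrite {1}(coord_basis be (memvf v)) !linear_sum mulmx_sum_row.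
by apply: eq_bigr => i _; rewrite !linearZ /= rowK mxE.
Qed.

Lemma lfun_mx_inj : injective lfun_mx.
Proof.
move=> f g fg; apply/lfunP => v; apply: (can_inj coords_ofK).
by rewrite !coords_of_app fg.
Qed.

Lemma mx_lfunK : cancel mx_lfun lfun_mx.
Proof.
move=> G; apply/row_matrixP => i; rewrite rowK lfunE /= of_coordsK.
suff -> : coords_of e`_i = delta_mx 0 i by rewrite -rowE.
apply/rowP => j; rewrite !mxE coord_free ?(basis_free be) //.
by rewrite eqxx eq_sym.
Qed.

Lemma lfun_mx_comp (f g : 'End(W)) :
  lfun_mx (f \o g)%VF = lfun_mx g *m lfun_mx f.
Proof.
by apply/row_matrixP => i; rewrite row_mul !rowK comp_lfunE coords_of_app.
Qed.

Lemma lfun_mx_id : lfun_mx \1%VF = 1%:M.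
Proof.
apply/row_matrixP => i; rewrite rowK id_lfunE row1.
apply/rowP => j; rewrite !mxE coord_free ?(basis_free be) //.
by rewrite eqxx eq_sym.
Qed.

Lemma mx_frameK Q : frame_mx (mx_frame Q) = Q.
Proof.
by apply/row_matrixP => i; rewrite rowK -tnth_nth tnth_mktuple of_coordsK.
Qed.

Lemma coords_of_frame_sum (e' : n.-tuple W) (k : 'I_n -> F) :
  coords_of (\sum_i k i *: e'`_i) = (\row_i k i) *m frame_mx e'.
Proof.
rewrite linear_sum mulmx_sum_row; apply: eq_bigr => i _.
by rewrite linearZ rowK mxE.
Qed.

Lemma frame_mx_unit (e' : n.-tuple W) : basis_of {:W} e' ->
  frame_mx e' \in unitmx.
Proof.
move=> /basis_free/freeP fe; rewrite -row_free_unit -kermx_eq0.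
apply/eqP/row_matrixP => i; rewrite row0; apply/rowP => j.
set u := row i _; have uQ : u *m frame_mx e' = 0.
  by apply/sub_kermxP; exact: row_sub.
rewrite [RHS]mxE (fe (u 0)) //; apply: (can_inj coords_ofK).
rewrite coords_of_frame_sum linear0 (_ : \row_i u 0 i = u) ?uQ //.
by apply/rowP => l; rewrite mxE.
Qed.

Lemma mx_frame_basis Q : Q \in unitmx -> basis_of {:W} (mx_frame Q).
Proof.
move=> uQ; rewrite basisEfree subvf size_tuple (size_basis be) leqnn !andbT.
apply/freeP => k sum0 i; have := coords_of_frame_sum (mx_frame Q) k.
rewrite sum0 linear0 mx_frameK => /esym/(congr1 (mulmx^~ (invmx Q))).
by rewrite mulmxK // mul0mx => /rowP/(_ i); rewrite !mxE.
Qed.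

End Frames.

Lemma lfun_mx_passmx (F : fieldType) (W : vectType F)
    (e : (\dim {:W}).-tuple W) (g : 'End(W)) : basis_of {:W} e ->
  lfun_mx e g = mxof e e g.
Proof.
move=> be; apply/row_matrixP => i; rewrite rowK rowE mul_mxof.
by rewrite vecof_delta; apply/rowP => j; rewrite !mxE.
Qed.

Section Forms.
Variables (R : realType) (W : vectType R[i]).

Lemma form_matrix_frame (n : nat) (e0 e : n.-tuple W) (w : bilform W) :
    basis_of {:W} e0 ->
  form_matrix e w = frame_mx e0 e *m form_matrix e0 w *m (frame_mx e0 e)^T.
Proof.
move=> b0.
have eE i : tnth e i = \sum_j frame_mx e0 e i j *: tnth e0 j.
  rewrite -[LHS](coords_ofK b0) /of_coords; apply: eq_bigr => j _.
  by rewrite [frame_mx _ _ _ _]mxE !(tnth_nth 0).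
apply/matrixP => i j; rewrite [LHS]mxE (eE j) linear_sum [RHS]mxE.
apply: eq_bigr => l _; rewrite linearZ /= (eE i) linear_sum sum_lfunE.
rewrite [(frame_mx _ _)^T l j]mxE [RHS]mulrC.
congr (_ * _); rewrite [RHS]mxE; apply: eq_bigr => k _.
by rewrite linearZ scale_lfunE [form_matrix e0 w k l]mxE.
Qed.

Lemma form_matrix_linear (n : nat) (e : n.-tuple W) : linear (form_matrix e).
Proof.
by move=> a u v; apply/matrixP => i j; rewrite !mxE !add_lfunE !scale_lfunE.
Qed.

HB.instance Definition _ (n : nat) (e : n.-tuple W) :=
  GRing.isSemilinear.Build R[i] _ _ _ (form_matrix e)
    (GRing.semilinear_linear (form_matrix_linear e)).

Lemma form_matrix_inj (n : nat) (e : n.-tuple W) : basis_of {:W} e ->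
  injective (form_matrix e).
Proof.
move=> be w w' /matrixP ww'; apply/lfunP => x; apply/lfunP => y.
rewrite (coord_basis be (memvf x)) (coord_basis be (memvf y)) !linear_sum.
apply: eq_bigr => j _; rewrite !linearZ /= !sum_lfunE; congr (_ * _).
apply: eq_bigr => i _; rewrite !linearZ !scale_lfunE; congr (_ * _).
by have := ww' i j; rewrite !mxE !(tnth_nth 0).
Qed.

Lemma skew_form_matrix (n : nat) (e : n.-tuple W) (w : bilform W) :
  skew_symmetric w -> (form_matrix e w)^T = - form_matrix e w.
Proof. by move=> sk; apply/matrixP => i j; rewrite !mxE sk. Qed.

(** Replaces the size [\dim {:W}] by [n] once and for all, keeping only the two facts about
    determinant and pullback used later. *)
Lemma adapted_frame (n : nat) : \dim {:W} = n -> exists e : n.-tuple W,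
  [/\ basis_of {:W} e, forall g, lfun_det g = \det (lfun_mx e g) &
  forall g w, form_matrix e (pullback g w) =
    lfun_mx e g *m form_matrix e w *m (lfun_mx e g)^T].
Proof.
move=> <-; have be := vbasisP {:W}; exists (vbasis {:W}); split => // [g|g w].
  by rewrite lfun_mx_passmx.
by rewrite lfun_mx_passmx // form_matrix_pullback.
Qed.

End Forms.

Section TensorCoordinates.
Variables (R : realType) (V W : vectType R[i]) (n : nat).
Variables (e : n.-tuple W) (be : basis_of {:W} e).
Local Notation index := ('I_(\dim {:V}) * 'I_n * 'I_n)%type.

Definition entry (psi : 'Hom(V, bilform W)) (x : index) : R[i] :=
  form_matrix e (psi (vbasis {:V})`_x.1.1) x.1.2 x.2.

Definition entries (psi : 'Hom(V, bilform W)) : {ffun index -> R[i]^o} :=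
  [ffun x => entry psi x].

Lemma entries_linear : linear entries.
Proof.
move=> a u v; apply/ffunP => x; rewrite !ffunE /entry.
by rewrite add_lfunE scale_lfunE linearP !mxE.
Qed.

HB.instance Definition _ :=
  GRing.isSemilinear.Build R[i] _ _ _ entries
    (GRing.semilinear_linear entries_linear).

Lemma entry_inj psi psi' : entry psi =1 entry psi' -> psi = psi'.
Proof.
move=> eqe; apply/lfunP => v; rewrite (coord_vbasis (memvf v)) !linear_sum.
apply: eq_bigr => k _; rewrite !linearZ; congr (_ *: _).
apply: (form_matrix_inj be); apply/matrixP => i j.
exact: (eqe (k, i, j)).
Qed.

Lemma lker_entries : lker (linfun entries) == 0%VS.
Proof.
apply/lker0P => psi psi'; rewrite !lfunE /= => /ffunP eqe.
by apply: entry_inj => x; have := eqe x; rewrite !ffunE.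
Qed.

Lemma limg_entries : limg (linfun entries) = fullv.
Proof.
apply/eqP; rewrite eqEdim subvf (limg_dim_eq _); last first.
  by apply/eqP; rewrite capfv; exact: lker_entries.
have dimW : dim W = n by rewrite -dimvf; exact: size_basis be.
(* Both dimensions are convertible to explicit products, which agree because [dim W = n]. *)
rewrite !dimvf -[X in (X <= _)%N]/(#|{: 'I_(dim V) * 'I_n * 'I_n}| * 1)%N.
rewrite -[X in (_ <= X)%N]/(dim V * (dim W * (dim W * 1)))%N dimW.
by rewrite /= !card_prod !card_ord !muln1 mulnA leqnn.
Qed.

Lemma entry_surj (T : index -> R[i]) : exists psi, entry psi =1 T.
Proof.
exists ((linfun entries)^-1%VF [ffun x => T x]) => x.
have := limg_lfunVK (f := linfun entries) (x := [ffun x => T x : R[i]^o]).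
rewrite limg_entries memvf => /(_ isT)/ffunP/(_ x).
by rewrite lfunE !ffunE.
Qed.

Definition hom_coords (psi : 'Hom(V, bilform W)) :
    'rV[R[i]^o]_(\dim {: 'Hom(V, bilform W)}) :=
  rVof (vbasis {: 'Hom(V, bilform W)}) psi.

(** With [entry_hom_coords], transfers continuity between matrix entries and the coordinates in
    which [vclosure] is defined. *)
Lemma hom_coords_entry : exists b : index -> 'rV[R[i]^o]_(\dim {: 'Hom(V, bilform W)}),
  forall psi, hom_coords psi = \sum_x entry psi x *: b x.
Proof.
pose inv := (linfun entries)^-1%VF.
exists (fun x => hom_coords (inv [ffun y => (x == y)%:R])) => psi.
rewrite -{1}(lker0_lfunK lker_entries psi) -/inv lfunE /=.
have -> : entries psi = \sum_x entry psi x *: [ffun y => (x == y)%:R].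
  apply/ffunP => y; rewrite sum_ffunE ffunE (bigD1 y) //= big1 => [|x xy].
    by rewrite !ffunE eqxx addr0; exact/esym/mulr1.
  by rewrite !ffunE (negPf xy); exact: mulr0.
rewrite /hom_coords !linear_sum; apply: eq_bigr => x _.
by rewrite !linearZ.
Qed.

Lemma entry_hom_coords :
  exists a : 'I_(\dim {: 'Hom(V, bilform W)}) -> index -> R[i],
  forall psi x, entry psi x = \sum_l hom_coords psi 0 l * a l x.
Proof.
exists (fun l x => entry (vbasis {: 'Hom(V, bilform W)})`_l x) => psi x.
have entryE psi' : entry psi' x = entries psi' x by rewrite ffunE.
rewrite entryE {1}(coord_vbasis (memvf psi)) linear_sum sum_ffunE.
apply: eq_bigr => l _; rewrite linearZ entryE ffunE; congr (_ * _).
by rewrite mxE.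
Qed.

End TensorCoordinates.

(** * Closures of sets of tensors through matrix entries *)

Section Closure.
Variables (R : realType) (V W : vectType R[i]) (n : nat).
Variables (e : n.-tuple W) (be : basis_of {:W} e).
Local Notation C := R[i].
Local Notation index := ('I_(\dim {:V}) * 'I_n * 'I_n)%type.
Implicit Types (S : set 'Hom(V, bilform W)) (psi : 'Hom(V, bilform W)).

(** A curve continuous at 0 with values in [S] away from 0 has its value at 0 in the closure; the
    point [r / 2] is a nonzero parameter in the ball of radius [r]. *)
Lemma vclosure_limit S psi0 (h : index -> C^o -> C^o) :
    (forall x, continuous (h x)) -> (forall x, h x 0 = entry e psi0 x) ->
    (forall t, t != 0 -> exists2 psi, S psi & forall x, entry e psi x = h x t) ->
  vclosure S psi0.
Proof.
move=> ch h0 hS; have [b bE] := hom_coords_entry V be.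
pose u (t : C^o) := \sum_x h x t *: b x.
have cu : continuous u.
  apply: continuous_mx => i j; under eq_fun do rewrite summxE.
  apply: continuous_sum => x _; under eq_fun do rewrite mxE.
  by apply: continuous_mul; [exact: ch | exact: (@cst_continuous _ C^o)].
move=> B nB.
have : nbhs (0 : C^o) (u @^-1` B).
  apply: cu; rewrite (_ : u 0 = hom_coords psi0) // bE.
  by apply: eq_bigr => x _; rewrite h0.
move=> /nbhs_ballP[r /= r_gt0 rB].
have t0 : r / 2 != 0 by rewrite mulf_neq0 ?invr_eq0 ?pnatr_eq0 // gt_eqF.
have [psi Spsi psiE] := hS _ t0.
exists (hom_coords psi); split; first by exists psi.
have -> : hom_coords psi = u (r / 2).
  by rewrite bE; apply: eq_bigr => x _; rewrite psiE.
apply: rB; rewrite -ball_normE /ball_ /= sub0r normrN gtr0_norm.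
  by rewrite ltr_pdivrMr ?ltr0n // mulr_natr mulr2n ltrDl.
by rewrite divr_gt0.
Qed.

Definition entry_norm psi : C := \sum_x `|entry e psi x|.

(** The entry norm is continuous, so only elements of [S] of norm close to that of [psi] matter near
    [psi]. *)
Lemma vclosure_bounded S psi (r : C) : 0 < r -> vclosure S psi ->
  vclosure (S `&` [set psi' | entry_norm psi' < entry_norm psi + r]) psi.
Proof.
move=> r_gt0 clS; have [a aE] := entry_hom_coords V e.
pose s (v : 'rV[C^o]_(\dim {: 'Hom(V, bilform W)})) : C^o :=
  \sum_x `|\sum_l v 0 l * a l x|.
have sE psi' : s (hom_coords psi') = entry_norm psi'.
  by apply: eq_bigr => x _; rewrite aE.
have cs : continuous s.
  apply: continuous_sum => x _; apply: continuous_normr.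
  apply: continuous_sum => l _; apply: continuous_mul; first exact: continuous_entry.
  exact: (@cst_continuous _ C^o).
move=> B nB.
have ns := continuous_nbhs_dist (hom_coords psi) cs r_gt0.
have [v [[psi' Spsi' <-] [Bv sv]]] := clS _ (filterI nB ns).
exists (hom_coords psi'); split=> //; exists psi' => //; split=> //=.
move: sv; rewrite /= !sE distrC => lt_r.
rewrite -ltrBlDl; apply: le_lt_trans lt_r; apply: real_ler_norm.
by rewrite rpredB // ger0_real //; apply: sumr_ge0.
Qed.

Lemma vclosure_neq0 S psi : vclosure S psi -> S !=set0.
Proof. by move=> /(_ setT filterT)[_ [[psi' Spsi' _] _]]; exists psi'. Qed.

Lemma vclosure_compact_image (T : topologicalType) (K : set T) S
    (f : T -> 'Hom(V, bilform W)) psi :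
    compact K -> (forall x, continuous (fun t => entry e (f t) x : C^o)) ->
    (S `<=` f @` K) -> vclosure S psi -> exists2 t, K t & f t = psi.
Proof.
move=> cK cf SK clS; have [b bE] := hom_coords_entry V be.
have chf : continuous (fun t => hom_coords (f t)).
  apply: continuous_mx => i j.
  under eq_fun do rewrite bE summxE.
  apply: continuous_sum => x _; under eq_fun do rewrite mxE.
  by apply: continuous_mul; [exact: cf | exact: (@cst_continuous _ C^o)].
have clK : closed ((fun t => hom_coords (f t)) @` K).
  apply: compact_closed; first exact: hausdorff_mx.
  by apply: continuous_compact cK; exact: continuous_subspaceT.
have [t Kt tE] : ((fun t => hom_coords (f t)) @` K) (hom_coords psi).
  apply: clK; apply: closure_subset clS => _ [psi' /SK[t Kt <-] <-].
  by exists t.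
exists t => //; apply: (can_inj (rVofK (vbasisP _))); exact: tE.
Qed.

End Closure.

(** * The criterion *)

(** If [g], [h] and [gh] are involutions, then [hg = g(ghgh)h = gh]; so the set commutes and the
    matrix result applies. *)
Lemma finite_lfun_involutions (F : fieldType) (W : vectType F) (S : set 'End(W)) :
    2%:R != 0 :> F -> (0 < \dim {:W})%N -> (forall g, S g -> (g \o g = \1)%VF) ->
    (forall g h, S g -> S h -> S (g \o h)%VF) ->
  finite_set S.
Proof.
move=> two_neq0; have := vbasisP {:W}; move: (vbasis {:W}).
case: (\dim {:W}) => // n e be _ invS mulS.
have comS g h : S g -> S h -> (g \o h = h \o g)%VF.
  move=> Sg Sh; have gh := invS _ (mulS _ _ Sg Sh).
  have ghgh f : (g \o (h \o (g \o (h \o f))))%VF = f.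
    by rewrite !comp_lfunA -(comp_lfunA (g \o h)%VF g h) gh comp_lfun1l.
  have -> : (h \o g = (g \o g) \o (h \o g) \o (h \o h))%VF.
    by rewrite !invS // comp_lfun1r comp_lfun1l.
  by rewrite -!comp_lfunA ghgh.
have finM : finite_set (lfun_mx e @` S).
  apply: (finite_commuting_involutions two_neq0).
    by move=> _ [g Sg <-]; rewrite -(lfun_mx_comp be) invS // lfun_mx_id.
  by move=> _ _ [g Sg <-] [h Sh <-]; rewrite -!(lfun_mx_comp be) comS.
apply: sub_finite_set (finite_image (mx_lfun e) finM) => g Sg.
exists (lfun_mx e g); first by exists g.
by apply: (lfun_mx_inj be); rewrite mx_lfunK.
Qed.

Lemma conj_invmxK (F : fieldType) n (G T : 'M[F]_n) : G \in unitmx ->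
  G *m (invmx G *m T *m G) *m invmx G = T.
Proof. by move=> uG; rewrite -!mulmxA mulmxV // mulmx1 mulKVmx. Qed.

(** Points of one orbit have conjugate stabilizers. *)
Lemma conj_stabilizer (F : fieldType) n (G T M L : 'M[F]_n) : G \in unitmx ->
    L = G *m M *m G^T -> T *m L *m T^T = L ->
  (invmx G *m T *m G) *m M *m (invmx G *m T *m G)^T = M.
Proof.
move=> uG LE fixL; rewrite !trmx_mul.
have -> : invmx G *m T *m G *m M *m (G^T *m (T^T *m (invmx G)^T)) =
    invmx G *m (T *m (G *m M *m G^T) *m T^T) *m (invmx G)^T.
  by rewrite !mulmxA.
rewrite -LE fixL LE !mulmxA mulVmx // mul1mx -mulmxA -trmx_mul.
by rewrite mulVmx // trmx1 mulmx1.
Qed.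

Section Criterion.
Variables (R : realType) (V W : vectType R[i]) (A : {vspace bilform W}).
Variable phi : 'Hom(V, bilform W).
Hypotheses (dimW : \dim {:W} = 6%N) (phi_img : limg phi = A).
Hypothesis skewA : forall w, w \in A -> skew_symmetric w.
Local Notation C := R[i].

Variable e : 6.-tuple W.
Hypotheses (be : basis_of {:W} e).
Hypothesis lfun_detE : forall g, lfun_det g = \det (lfun_mx e g).
Hypothesis form_matrixE : forall g w,
  form_matrix e (pullback g w) =
    lfun_mx e g *m form_matrix e w *m (lfun_mx e g)^T.

Definition form_mx (k : 'I_(\dim {:V})) : 'M[C]_6 :=
  form_matrix e (phi (vbasis {:V})`_k).

Lemma phi_in_A v : phi v \in A.
Proof. by rewrite -phi_img memv_img ?memvf. Qed.

Lemma skew_form_mx k : (form_mx k)^T = - form_mx k.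
Proof. by apply: skew_form_matrix; apply: skewA; exact: phi_in_A. Qed.

Lemma entry_act g x : entry e (act g phi) x =
  (lfun_mx e g *m form_mx x.1.1 *m (lfun_mx e g)^T) x.1.2 x.2.
Proof. by rewrite /entry actE form_matrixE. Qed.

Lemma entry_norm_act g :
  entry_norm e (act g phi) = orbit_norm form_mx (lfun_mx e g).
Proof.
rewrite /orbit_norm /l1norm /entry_norm; under eq_bigr do rewrite entry_act.
rewrite -(pair_bigA _ (fun ki j => `|(lfun_mx e g *m form_mx ki.1 *m
  (lfun_mx e g)^T) ki.2 j|)) /=.
by rewrite -(pair_bigA _ (fun k i => \sum_j `|(lfun_mx e g *m form_mx k *m
  (lfun_mx e g)^T) i j|)).
Qed.

Lemma flagged_mx t : flagged A t <-> mx_flagged form_mx t.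
Proof.
split=> [[e' [be' [s [s13 flagP]]]]|[Q uQ [s s13 flagP]]].
  exists (frame_mx e e'); first exact: frame_mx_unit.
  exists s => // k [i j] /and3P[/= i_s ij js].
  rewrite -form_matrix_frame // mxE.
  by apply: flagP => //; exact: phi_in_A.
exists (mx_frame e Q); split; first exact: mx_frame_basis.
exists s; split => // w; rewrite -phi_img => /memv_imgP[v _ ->] i j i_s ij js.
have <- : form_matrix (mx_frame e Q) (phi v) i j =
    phi v (tnth (mx_frame e Q) i) (tnth (mx_frame e Q) j) by rewrite mxE.
rewrite (coord_vbasis (memvf v)) !linear_sum summxE big1 // => k _.
rewrite !linearZ mxE /= (form_matrix_frame _ _ be) mx_frameK //.
rewrite (flagP k (i, j)) ?mulr0 //; exact/and3P.
Qed.

(** Vanishing of an entry is linear in the form, so it can be tested on generators. *)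
Lemma flagged_omega n (omega : n.-tuple (bilform W)) t : <<omega>>%VS = A ->
  flagged A t <-> exists e : 6.-tuple W, basis_of {:W} e /\
       exists s : nat, (1 <= s <= 3)%N /\
         forall (i j : 'I_6) (k : 'I_n),
           (i.+1 <= s)%N -> (i < j)%N -> (j.+1 <= t - s)%N ->
           form_matrix e (tnth omega k) i j = 0.
Proof.
move=> spanA; split=> -[e' [be' [s [s13 flagP]]]]; exists e'; split => //;
  exists s; split => //.
  move=> i j k i_s ij js; rewrite mxE; apply: flagP => //.
  by rewrite -spanA memv_span // mem_tnth.
move=> w wA i j i_s ij js.
have <- : form_matrix e' w i j = w (tnth e' i) (tnth e' j) by rewrite mxE.
rewrite -spanA in wA; rewrite (coord_span wA) linear_sum summxE big1 // => k _.
by rewrite linearZ mxE -tnth_nth flagP // mulr0.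
Qed.

Lemma SL_mx_lfun (G : 'M[C]_6) : \det G = 1 -> SL W (mx_lfun e G).
Proof. by move=> dG; rewrite /SL /= lfun_detE mx_lfunK. Qed.

Lemma unstable_flagged : vclosure (SL_orbit phi) 0 <-> flagged A 7.
Proof.
rewrite flagged_mx; split=> [cl0|/(strict_destabilizing skew_form_mx)].
  (* The gap [c] also serves as radius: near 0 there would be an orbit point of norm below [c]. *)
  apply: contrapT => /orbit_norm_gap[c c_gt0 cP].
  have [_ [[g SLg <-]]] := vclosure_neq0 (vclosure_bounded e c_gt0 cl0).
  rewrite /= entry_norm_act [X in _ < X + _]big1 => [|x _].
    have dG : \det (lfun_mx e g) = 1 by rewrite -lfun_detE.
    by rewrite add0r => /(le_lt_trans (cP _ dG)); rewrite ltxx.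
  by rewrite /entry lfunE /= linear0 mxE normr0.
move=> [Q [l [uQ sum_l wtP]]].
have wtP' k i j : l i + l j < 0 -> (Q *m form_mx k *m Q^T) i j = 0.
  by move=> lt0; apply: wtP; exact: ltW.
apply: (vclosure_limit be
  (h := fun x t => torus_path form_mx Q l t x.1.1 x.1.2 x.2)).
- by move=> x; exact: continuous_torus_path.
- move=> x; rewrite torus_path0_eq0 // /entry lfunE /= linear0.
  by rewrite [LHS]mxE [RHS]mxE.
- move=> t t0; exists (act (mx_lfun e (torus_elt Q l t)) phi).
    exists (mx_lfun e (torus_elt Q l t)) => //.
    by apply: SL_mx_lfun; exact: det_torus_elt.
  by move=> x; rewrite entry_act (mx_lfunK be) (torus_pathE uQ wtP' _ t0).
Qed.

Lemma lker_SL g : SL W g -> lker g = 0%VS.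
Proof.
rewrite /SL /= lfun_detE => dg; apply/eqP; rewrite -subv0; apply/subvP => x.
rewrite memv_ker memv0 => /eqP gx0; apply/eqP.
apply: (can_inj (coords_ofK be)); rewrite linear0.
have ug : lfun_mx e g \in unitmx by rewrite unitmxE dg unitr1.
have := coords_of_app be g x; rewrite gx0 linear0.
by move=> /esym/(congr1 (mulmx^~ (invmx (lfun_mx e g)))); rewrite mulmxK ?mul0mx.
Qed.

Lemma SL_stabilizer_comp g h : SL_stabilizer phi g -> SL_stabilizer phi h ->
  SL_stabilizer phi (g \o h)%VF.
Proof.
move=> [SLg phig] [SLh phih]; split.
  move: SLg SLh; rewrite /SL /= !lfun_detE (lfun_mx_comp be) det_mulmx => -> ->.
  exact: mulr1.
apply/lfunP => v; apply/lfunP => x; apply/lfunP => y.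
have /lfunP/(_ v)/lfunP/(_ (h x))/lfunP/(_ (h y)) := phig.
rewrite !actE !pullbackE !comp_lfunE => ->.
by rewrite -[in RHS]phih actE pullbackE.
Qed.

Lemma stabilizer_invariant g w x y : SL_stabilizer phi g -> w \in A ->
  w (g x) (g y) = w x y.
Proof.
move=> [_ phig]; rewrite -phi_img => /memv_imgP[v _ ->].
by rewrite -[in RHS]phig actE pullbackE.
Qed.

Lemma finite_SL_stabilizer : ~ flagged A 6 -> finite_set (SL_stabilizer phi).
Proof.
move=> nflag; apply: finite_lfun_involutions.
- by rewrite pnatr_eq0.
- by rewrite dimW.
- move=> g Sg; apply: (invariance_involutive dimW skewA) => //.
    by apply: lker_SL; case: Sg.
  by move=> w x y wA; exact: stabilizer_invariant.
- exact: SL_stabilizer_comp.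
Qed.

(** Near [psi] the orbit points have norm below [b], so by properness they come from the compact set
    [K] of matrices of determinant 1; the image of [K] is closed and hence contains [psi]. *)
Lemma closed_SL_orbit : ~ flagged A 6 -> vclosure (SL_orbit phi) = SL_orbit phi.
Proof.
rewrite flagged_mx => nflag; apply/seteqP; split => [psi clpsi|psi Opsi]; last first.
  by apply: subset_closure; exists psi.
pose b := entry_norm e psi + 1.
have b_ge0 : 0 <= b by rewrite addr_ge0 // sumr_ge0.
have [b' b'P] := orbit_norm_proper b_ge0 nflag.
pose K := [set G : 'M[C^o]_6 | (forall i j, complex_square b' (G i j)) /\
  \det G = 1 :> C^o].
have cK : compact K.
  by apply: compact_bounded_level; apply: continuous_det; exact: continuous_entry.
have [G [_ dG] <-] : exists2 G, K G & act (mx_lfun e G) phi = psi.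
  apply: (vclosure_compact_image be cK _ _ (vclosure_bounded e ltr01 clpsi)).
    move=> x; under eq_fun do rewrite entry_act mx_lfunK //.
    exact: continuous_conj_entry.
  move=> _ [[g SLg <-]]; rewrite /= entry_norm_act => /ltW le_b.
  have dg : \det (lfun_mx e g) = 1 by rewrite -lfun_detE.
  exists (lfun_mx e g).
    by split=> // i j; apply: norm_le_complex_square; exact: b'P.
  by congr act; apply: (lfun_mx_inj be); rewrite mx_lfunK.
by exists (mx_lfun e G) => //; exact: SL_mx_lfun.
Qed.

Lemma flagged_not_stable : flagged A 6 -> ~ stable phi.
Proof.
rewrite flagged_mx => /(weak_destabilizing skew_form_mx)[Q [l [uQ sum_l l0 wtP]]].
move=> [closed_orbit fin_stab].
pose T t := torus_elt Q l t.
pose L t := torus_path form_mx Q l t.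
(* The limit at 0 of the one-parameter orbit, realized as a tensor; a closed orbit must contain
   it. *)
have [psi0 psi0E] := entry_surj be (fun x => L 0 x.1.1 x.1.2 x.2).
have : SL_orbit phi psi0.
  rewrite -closed_orbit; apply: (vclosure_limit be
    (h := fun x t => L t x.1.1 x.1.2 x.2)).
  - by move=> x; exact: continuous_torus_path.
  - by move=> x; rewrite psi0E.
  - move=> t t0; exists (act (mx_lfun e (T t)) phi).
      exists (mx_lfun e (T t)) => //.
      by apply: SL_mx_lfun; exact: det_torus_elt.
    by move=> x; rewrite entry_act (mx_lfunK be) /L (torus_pathE uQ wtP _ t0).
move=> [g SLg gphi].
have dg : \det (lfun_mx e g) = 1 by rewrite -lfun_detE.
have ug : lfun_mx e g \in unitmx by rewrite unitmxE dg unitr1.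
have LE k : L 0 k = lfun_mx e g *m form_mx k *m (lfun_mx e g)^T.
  apply/matrixP => i j; have psi0_kij := psi0E (k, i, j).
  rewrite -gphi (entry_act g (k, i, j)) in psi0_kij; exact/esym/psi0_kij.
(* The torus fixes [psi0 = g.phi], so its conjugate by [g] fixes [phi]. *)
pose conjT t := invmx (lfun_mx e g) *m T t *m lfun_mx e g.
have conjT_stab t : t != 0 -> SL_stabilizer phi (mx_lfun e (conjT t)).
  move=> t0; split.
    apply: SL_mx_lfun; rewrite /conjT /T 2!det_mulmx (det_torus_elt uQ sum_l t0).
    by rewrite mulr1 -det_mulmx (mulVmx ug) det1.
  apply: (entry_inj be) => x; rewrite entry_act mx_lfunK //.
  rewrite -[entry e phi x]/(form_mx x.1.1 x.1.2 x.2); congr (fun_of_matrix _ _ _).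
  exact: conj_stabilizer ug (LE _) (torus_path0_fixed _ _ uQ _ t0).
have two_pow_inj : injective (fun n : nat => (2%:R : C) ^+ n).
  move=> a b; rewrite /= -!natrX => /eqP; rewrite eqr_nat eqn_exp2l // => /eqP //.
(* Powers of 2 supply infinitely many distinct nonzero parameters, hence infinitely many stabilizer
   elements. *)
pose f n := mx_lfun e (conjT (2%:R ^+ n)).
have f_inj : injective f.
  move=> a b /(can_inj (mx_lfunK be)) eq_conj.
  apply/two_pow_inj/(torus_elt_inj uQ l0).
  have conjTK t : lfun_mx e g *m conjT t *m invmx (lfun_mx e g) = T t.
    exact: conj_invmxK (T t) ug.
  exact: etrans (esym (conjTK _)) (etrans
    (congr1 (fun X => lfun_mx e g *m X *m invmx (lfun_mx e g)) eq_conj) (conjTK _)).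
have : finite_set (f @^-1` SL_stabilizer phi).
  by apply: finite_preimage fin_stab => a b _ _; exact: f_inj.
rewrite (_ : _ @^-1` _ = setT); first exact: infinite_nat.
apply/seteqP; split=> // a _; apply: conjT_stab.
by rewrite expf_neq0 // pnatr_eq0.
Qed.

Lemma not_stable_flagged : ~ stable phi <-> flagged A 6.
Proof.
split=> [nst|]; last exact: flagged_not_stable.
apply: contrapT => nflag; apply: nst; split.
  exact: closed_SL_orbit.
exact: finite_SL_stabilizer.
Qed.

End Criterion.

Theorem theorem3p1 (R : realType) (W : vectType R[i])
    (hW : \dim {:W} = 6%N)
    (n : nat) (A : {vspace bilform W})
    (hA : forall w : bilform W, w \in A -> skew_symmetric w)
    (dimA : \dim A = n.+1)
    (omega : n.+1.-tuple (bilform W)) (homega : <<omega>>%VS = A)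
    (V : vectType R[i]) (hV : \dim {:V} = n.+1)
    (phi : 'Hom(V, bilform W))
    (phi_inj : injective phi) (phi_img : limg phi = A) :
  (~ semistable phi <->
     exists e : 6.-tuple W, basis_of {:W} e /\
       exists s : nat, (1 <= s <= 3)%N /\
         forall (i j : 'I_6) (k : 'I_n.+1),
           (i.+1 <= s)%N -> (i < j)%N -> (j.+1 <= 7 - s)%N ->
           form_matrix e (tnth omega k) i j = 0)
  /\
  (~ stable phi <->
     exists e : 6.-tuple W, basis_of {:W} e /\
       exists s : nat, (1 <= s <= 3)%N /\
         forall (i j : 'I_6) (k : 'I_n.+1),
           (i.+1 <= s)%N -> (i < j)%N -> (j.+1 <= 6 - s)%N ->
           form_matrix e (tnth omega k) i j = 0).
Proof.
have [e [be lfun_detE form_matrixE]] := adapted_frame hW.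
rewrite -!(flagged_omega _ homega); split; last first.
  exact: (not_stable_flagged hW phi_img hA be lfun_detE form_matrixE).
rewrite -(unstable_flagged phi_img hA be lfun_detE form_matrixE).
(* [semistable] is itself a negation, so one direction eliminates a double negation. *)
by split=> [|? ?] //; exact: contrapT.
Qed.
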